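(* Let $n>1$ and $d\ge 2$ be integers, let $r\in\{1,-1\}$ with $n\equiv r \pmod d$, let $c,e$ be indeterminates, and let $W=(n-r)/d$ or $W=n-1$. Then, modulo $[n]\Phi_n(q)^3$, \begin{align*} &\sum_{k=0}^W[2dk+r]\frac{\left(q^r;q^d\right)^4_k\left(cq^r,eq^r;q^d\right)_k}{{\left(q^d;q^d\right)^4_k} \left(q^d/c,q^d/e;q^d\right)_k}(ce)^{-k}q^{(2d-3r)k}\\ &\equiv[n]\frac{q^{r(r-n)/d}}{\left(q^d;q^d\right)_{(n-r)/d}}\left (1-[n]^2\sum_{i=1}^{(n-r)/d}\frac{q^{di}}{[di]^2}\right) \sum_{k=0}^{(n-r)/d}\frac{\left(q^{2r+dk};q^d\right)_{(n-r)/d-k}(q^{d-r}/(ce);q^d)_k\left(q^{r};q^d\right)^3_k} {\left(q^d/c,q^d/e,q^d;q^d\right)_k}q^{dk}. \end{align*}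
   Context: $q$ is an indeterminate. The $q$-shifted factorial is $(a;q)_0=1$, $(a;q)_m=(1-a)(1-aq)\cdots(1-aq^{m-1})$ for positive integers $m$, and $(a_1,\dots,a_s;q)_m=(a_1;q)_m\cdots(a_s;q)_m$; $(a;q)_m^j$ means $((a;q)_m)^j$. For an integer $m$, $[m]=(1-q^m)/(1-q)$. $\Phi_n(q)$ is the $n$-th cyclotomic polynomial. For rational functions $A,B$ in $q$ and the parameters, and a polynomial $P$ in $q$, $A\equiv B \pmod P$ means that $A-B=P\cdot F/G$ with $F,G$ polynomials and $G$ coprime to $P$. *)

(* Defs.v *)
From HB Require Import structures.
From mathcomp Require Import all_boot all_order all_algebra all_field.
Set Implicit Arguments. Unset Strict Implicit. Unset Printing Implicit Defensive.
Import Order.TTheory GRing.Theory Num.Theory.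
Local Open Scope ring_scope.

(* Coefficient field K = Q(c,e): fractions of bivariate polynomials over rat,
   modelled as {poly {poly rat}} (inner variable = c, outer variable = e). *)
Definition Kce : fieldType := {fraction {poly {poly rat}}}.

Definition Fq : fieldType := {fraction {poly Kce}}.

Definition qv : Fq := tofrac ('X : {poly Kce}).
Definition cv : Fq := tofrac ((tofrac (('X : {poly rat})%:P : {poly {poly rat}}) : Kce)%:P).
Definition ev : Fq := tofrac ((tofrac ('X : {poly {poly rat}}) : Kce)%:P).

Definition qpoch (a x : Fq) (m : nat) : Fq := \prod_(i < m) (1 - a * x ^+ i).

Definition qint (m : int) : Fq := (1 - qv ^ m) / (1 - qv).

Definition qintP (n : nat) : {poly Kce} := \sum_(i < n) 'X^i.

Definition PhiP (n : nat) : {poly Kce} := map_poly (fun z : int => z%:~R) 'Phi_n.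

Definition qcong (A B : Fq) (P : {poly Kce}) : Prop :=
  exists (F G : {poly Kce}),
    [/\ G != 0, coprimep G P & A - B = tofrac (P * F) / tofrac G].

(* (n - r)/d as a natural number (exact division when n = r mod d). *)
Definition Mof (n d : nat) (r : int) : nat := `|((n%:Z - r) %/ d)%Z|%N.

(* Main.v *)
Require Import Defs.
From HB Require Import structures.
From mathcomp Require Import all_boot all_order all_algebra all_field.
From mathcomp Require Import ring zify.
Import Order.TTheory GRing.Theory Num.Theory.
Local Open Scope ring_scope.

(** Write [x = q^d], [al = q^r], [M = (n-r)/d], so that [al x^M = q^n], and let
    [f_k(u) = prod_(i<k) (1 - u al x^i)/(u - x^(i+1))] ([wpf] below).  Up to the factor
    [1/(1-q)] the left-hand side is [S(1,1,1)], where [S(u,v,w)] is the sum of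
    [(1 - al x^(2k)) (x^2/al^3)^k f_k(1) f_k(c) f_k(e) f_k(u) f_k(v) f_k(w)].

    For [u0 = q^(-n)] the sum [S(u0,v,w)] terminates and is evaluated by Watson's
    8phi7 transformation.  The combination
    [S(1,1,1) - 3 S(u0,1,1) + 3 S(u0,u0,1) - S(u0,u0,u0)] replaces
    [f_k(u) f_k(v) f_k(w)] by [(f_k(1) - f_k(u0))^3], which is divisible by
    [Phi_n^3]; reversing the sum ([k -> M-k]) makes the quotient antisymmetric
    modulo [Phi_n], which gives [Phi_n^4].  The finite differences of the
    Watson sums then recombine into the right-hand side modulo [Phi_n^4].

    For a proper divisor [m > 1] of [n] both sides vanish modulo [Phi_m]: the
    left one by the same antisymmetry within blocks of [m] consecutive terms,
    the right one by counting the zeros of the q-shifted factorials. *)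

(** Watson's formula needs a parameter with u al x^M = 1, and u = 1 misses this because al x^M =
    q^n. So the value at (1,1,1) is extrapolated from the three sums containing u0. Both sides of
    the extrapolation have error of order four. For the series, three orders come from the
    differences and one from the antisymmetry. For the Watson values, one comes from the explicit
    factor 1 - q^n and three from the third difference. The bracket with [n]^2 is what is left of
    the product of (q^n - x^i)(q^(-n) - x^i)/(1 - x^i)^2 over i = 1..M. Since [n] is the product of
    the Phi_m over the divisors m > 1 of n, the modulus is Phi_n^4 times the Phi_m with m proper,
    all pairwise coprime, and each can be treated in its own local ring. There 1 - q^m serves as
    uniformizer in place of Phi_m, because every zero and pole to be counted comes from a factor 1 -
    q^j. *)

Set Implicit Arguments. Unset Strict Implicit. Unset Printing Implicit Defensive.

(** * Watson's transformation of terminating very-well-poised series *)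

Section Transformation.
Variable F : fieldType.
Implicit Types a x u v w c e al : F.

Definition poch a x m : F := \prod_(i < m) (1 - a * x ^+ i).

(** Denominators are u - x^(i+1) and not 1 - x^(i+1)/u: the resulting powers u^(-k) absorb the
    (ce)^(-k) of the summand and the u, v, w in the argument of Watson's series. *)
Definition wpf x al u k : F :=
  \prod_(i < k) ((1 - u * al * x ^+ i) / (u - x ^+ i.+1)).

Definition wph x u k : F := \prod_(i < k) (u - x ^+ i.+1).

Definition wpg x al k : F := (1 - al * x ^+ (2 * k)) * (x ^+ 2 / al ^+ 3) ^+ k.

Lemma poch0 a x : poch a x 0 = 1. Proof. exact: big_ord0. Qed.

Lemma pochS a x m : poch a x m.+1 = poch a x m * (1 - a * x ^+ m).
Proof. exact: big_ord_recr. Qed.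

Lemma pochSl a x m : poch a x m.+1 = (1 - a) * poch (a * x) x m.
Proof.
rewrite /poch big_ord_recl expr0 mulr1; congr (_ * _).
by apply: eq_bigr => i _; rewrite lift0 exprS mulrA.
Qed.

Lemma poch_eq0 a x m i : (i < m)%N -> 1 - a * x ^+ i = 0 -> poch a x m = 0.
Proof. by move=> lim h; rewrite /poch (bigD1 (Ordinal lim)) //= h mul0r. Qed.

Lemma wpfS x al u k :
  wpf x al u k.+1 = wpf x al u k * ((1 - u * al * x ^+ k) / (u - x ^+ k.+1)).
Proof. exact: big_ord_recr. Qed.

Lemma wphS x u k : wph x u k.+1 = wph x u k * (u - x ^+ k.+1).
Proof. exact: big_ord_recr. Qed.

Lemma wph_neq0 x u k :
  (forall i, (0 < i <= k)%N -> u - x ^+ i != 0) -> wph x u k != 0.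
Proof. by move=> h; apply/prodf_neq0 => i _; apply: h; rewrite /= ltn_ord. Qed.

Lemma wpfE x al u k : wpf x al u k = poch (u * al) x k / wph x u k.
Proof. by rewrite /wpf big_split /= prodfV. Qed.

Lemma expr_prod_ord a n : a ^+ n = \prod_(i < n) a.
Proof. by rewrite prodr_const card_ord. Qed.

Lemma poch_divE x u k : u != 0 -> poch (x / u) x k = wph x u k / u ^+ k.
Proof.
move=> u0; rewrite expr_prod_ord -prodfV -big_split /=.
by apply: eq_bigr => i _; rewrite exprS; field.
Qed.

(** Coefficient of the balanced 3phi2 with upper parameters x^(-k), al x^k, x/(al c e) and lower
    parameters x/c, x/e, stripped of the two factors that depend on k. *)
Definition saal_coef x al c e j : F :=
  poch (x / (al * c * e)) x j * (c * e * x) ^+ j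
    / (wph x 1 j * wph x c j * wph x e j).

(** The closed form in [q_saalschutz] satisfies a first-order recurrence in k. Applied to the j-th
    summand, that recurrence leaves a discrete difference in j, whose antiderivative is the
    right-hand side. *)
Lemma saal_partial x al c e k J :
    x != 0 -> al != 0 -> c != 0 -> e != 0 ->
    wph x 1 J != 0 -> wph x c J != 0 -> wph x e J != 0 ->
  \sum_(j < J.+1)
    ((c - x ^+ k.+1) * (e - x ^+ k.+1)
       * (poch (x ^- k.+1) x j * poch (al * x ^+ k.+1) x j * saal_coef x al c e j)
     - x / al * (1 - c * al * x ^+ k) * (1 - e * al * x ^+ k)
       * (poch (x ^- k) x j * poch (al * x ^+ k) x j * saal_coef x al c e j))
  = c * e * (1 - x * al * x ^+ k ^+ 2)
    * (poch (x ^- k) x J * poch (al * x ^+ k.+1) x J)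
    * poch (x / (al * c * e)) x J.+1 * (c * e) ^+ J
    / (wph x 1 J * wph x c J * wph x e J).
Proof.
move=> x0 al0 c0 e0; have X0 : x ^+ k != 0 by rewrite expf_neq0.
elim: J => [_ _ _| J IH].
  rewrite big_ord_recl big_ord0 /saal_coef /= !pochS !poch0 /wph !big_ord0 !expr0.
  rewrite !exprS; move: (x ^+ k) X0 => X X0; field.
  by rewrite ?X0 ?x0 al0 c0 e0 oner_eq0.
rewrite !wphS !mulf_eq0 !negb_or => /andP[p1 d1] /andP[pc dc] /andP[pe de].
rewrite big_ord_recr /= {}IH //.
(* The shifted factorials in k are reduced to those based at x^(-k) and al x^(k+1), of length J;
   what is left is a rational identity in x^k and x^J. *)
rewrite (_ : poch (x ^- k.+1) x J.+1 = (1 - x ^- k.+1) * poch (x ^- k) x J);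
  last by rewrite pochSl exprS; congr (_ * poch _ _ _); field; rewrite X0 x0.
rewrite (_ : poch (al * x ^+ k) x J.+1 =
   (1 - al * x ^+ k) * poch (al * x ^+ k.+1) x J);
  last by rewrite pochSl exprS; congr (_ * poch _ _ _); ring.
rewrite /saal_coef !wphS (pochS (x / (al * c * e)) _ J.+1) !(pochS _ _ J).
move: d1 dc de; rewrite !exprMn !exprS.
move: (wph x 1 J) (wph x c J) (wph x e J) p1 pc pe => p1 p2 p3.
move: (poch (x / (al * c * e)) x J) (poch (x ^- k) x J) => p4 p5.
move: (poch _ x J) => p6.
move: (c ^+ J) (e ^+ J) => cJ eJ.
move: (x ^+ k) (x ^+ J) X0 => X Y X0 p10 p20 p30 h1 h2 h3.
by field; rewrite p10 p20 p30 h1 h2 h3 X0 x0 c0 e0 al0.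
Qed.

Lemma poch_xV_eq0 x k j : x != 0 -> (k < j)%N -> poch (x ^- k) x j = 0.
Proof.
by move=> x0 kj; apply: (poch_eq0 kj); rewrite mulVf ?subrr // expf_neq0.
Qed.

Lemma wph_neq0_le x u k j : (j <= k)%N -> wph x u k != 0 -> wph x u j != 0.
Proof.
move=> jk /prodf_neq0 h; apply/prodf_neq0 => i _.
exact: (h (widen_ord jk i)).
Qed.

(* Induction on k: both sides satisfy the same first-order recurrence, by the
   telescoping of [saal_partial]. *)
Lemma q_saalschutz x al c e k :
    x != 0 -> al != 0 -> c != 0 -> e != 0 ->
    wph x 1 k != 0 -> wph x c k != 0 -> wph x e k != 0 ->
  \sum_(j < k.+1) poch (x ^- k) x j * poch (al * x ^+ k) x j * saal_coef x al c e j
  = wpf x al c k * wpf x al e k * (x / al) ^+ k.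
Proof.
move=> x0 al0 c0 e0; elim: k => [|k IH] h1 hc he.
  by rewrite big_ord1 /saal_coef /wpf /wph !poch0 !big_ord0 !expr0 !mulr1 ?divr1 ?mulr1.
have := saal_partial k x0 al0 c0 e0 h1 hc he.
(* With J = k+1 the antiderivative contains 1 - x^(-k) x^k = 0, and so does the last term of the sum
   belonging to k. *)
rewrite [X in _ = _ * (X * _) * _ * _ / _](@poch_xV_eq0 x k k.+1) //.
rewrite mul0r mulr0 !mul0r sumrB -!mulr_sumr => /eqP.
rewrite subr_eq0 [X in _ == _ * X]big_ord_recr /= (@poch_xV_eq0 x k k.+1) //.
rewrite !mul0r addr0 {}IH ?(wph_neq0_le (leqnSn k)) // => /eqP.
move: hc he; rewrite !wphS !mulf_eq0 !negb_or => /andP[_ dc] /andP[_ de] E.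
apply: (mulfI (mulf_neq0 dc de)); rewrite E !wpfS [(x / al) ^+ k.+1]exprS.
by field; rewrite dc de al0.
Qed.

(** The 6phi5 with parameters u al, v al, w al is summable at argument x/(al^2 u v w); the u v w
    sits inside the [wpf] factors. *)
Definition phi65_term x al u v w k : F :=
  (x / al ^+ 2) ^+ k
    * (wpf x al 1 k * wpf x al u k * wpf x al v k * wpf x al w k).

(* WZ certificate for the terminating 6phi5 sum: consecutive values of [j] differ
   by a sum telescoping in [k]. *)
Lemma phi65_partial x al u v w j K :
    x != 0 -> al != 0 ->
    wph x 1 K != 0 -> wph x u K != 0 -> wph x v K != 0 -> wph x w K != 0 ->
  \sum_(k < K.+1) (1 - al * x ^+ (2 * k)) * phi65_term x al u v w k
     * ((1 - u * al * x ^+ j) * (1 - v * al * x ^+ j) * (1 - w * al * x ^+ j)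
          * (poch (x ^- k) x j * poch (al * x ^+ k) x j)
        - (1 - u * v * w * al ^+ 2 * x ^+ j)
          * (poch (x ^- k) x j.+1 * poch (al * x ^+ k) x j.+1))
  = x ^+ j / x ^+ K * phi65_term x al u v w K * poch (x ^- K) x j
    * poch (al * x ^+ K) x j.+1 
    * ((1 - u * al * x ^+ K) * (1 - v * al * x ^+ K) * (1 - w * al * x ^+ K)).
Proof.
move=> x0 al0.
have X0 k : x ^+ k != 0 by rewrite expf_neq0.
elim: K => [_ _ _ _| K IH].
  rewrite big_ord1 /phi65_term /wpf !big_ord0 muln0 !expr0 invr1 !pochS !mulr1.
  rewrite ?mulr1 ?mul1r.
  case: j => [|j]; first by rewrite !poch0 expr0; ring.
  by rewrite !pochSl subrr; ring.
rewrite !wphS !mulf_eq0 !negb_or.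
move=> /andP[p1 d1] /andP[pu du] /andP[pv dv] /andP[pw dw].
rewrite big_ord_recr /= {}IH //.
have -> : x ^+ j / x ^+ K * phi65_term x al u v w K * poch (x ^- K) x j
    * poch (al * x ^+ K) x j.+1 
    * ((1 - u * al * x ^+ K) * (1 - v * al * x ^+ K) * (1 - w * al * x ^+ K))
  = - (al ^+ 2 * x ^+ j) * phi65_term x al u v w K.+1 
    * (poch (x ^- K.+1) x j.+1 * poch (al * x ^+ K.+1) x j)
    * ((u - x ^+ K.+1) * (v - x ^+ K.+1) * (w - x ^+ K.+1)).
  rewrite (_ : poch (x ^- K.+1) x j.+1 = (1 - x ^- K.+1) * poch (x ^- K) x j);
    last by rewrite pochSl exprS; congr (_ * poch _ _ _); field; rewrite X0 x0.
  rewrite (_ : poch (al * x ^+ K) x j.+1 =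
     (1 - al * x ^+ K) * poch (al * x ^+ K.+1) x j);
    last by rewrite pochSl exprS; congr (_ * poch _ _ _); ring.
  rewrite /phi65_term !wpfS (exprS (x / al ^+ 2)).
  move: (wpf x al 1 K) (wpf x al u K) (wpf x al v K) (wpf x al w K).
  move: (poch _ x j) (poch _ x j) ((x / al ^+ 2) ^+ K) => p1' p2 p3 f1 f2 f3 f4.
  move: d1 du dv dw; rewrite !exprS; move: (x ^+ K) (x ^+ j) (X0 K) => X Y hX.
  by move=> d1 du dv dw; field; rewrite d1 du dv dw hX x0 al0.
rewrite !pochS mulnC exprM.
move: (phi65_term _ _ _ _ _ _) (poch _ x j) (poch _ x j) => g p2 p3.
move: (x ^+ K.+1) (x ^+ j) (X0 K.+1) => X Y hX.
by field.
Qed.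

Lemma prod_ord_rev (G : nat -> F) N :
  \prod_(i < N) G i = \prod_(i < N) G (N - i.+1)%N.
Proof. by rewrite (reindex_inj rev_ord_inj). Qed.

Lemma wph_polexM x al N :
  wph x (al * x ^+ N) N = \prod_(i < N) (- x ^+ i.+1) * poch al x N.
Proof.
rewrite /poch (prod_ord_rev (fun i => 1 - al * x ^+ i)) -big_split /=.
apply: eq_bigr => i _.
by rewrite -{1}(subnK (ltn_ord i)) exprD; ring.
Qed.

Lemma poch_xV x N : x != 0 ->
  poch (x ^- N) x N = wph x 1 N * \prod_(i < N) (- x ^- i.+1).
Proof.
move=> x0; rewrite /poch (prod_ord_rev (fun i => 1 - x ^- N * x ^+ i)).
rewrite -big_split /=; apply: eq_bigr => i _.
rewrite -{1}(subnK (ltn_ord i)) exprD; field.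
by rewrite !expf_neq0.
Qed.

(** Descending induction on j, starting at j = N where only the term k = N survives. The factor
    [wph x (al * x ^+ N) N] is (al;x)_N up to a monomial; this form is kept because for al x^N = q^n
    it pairs with [wph] at q^(-n) in [wph_pair_mod]. *)
Lemma phi65_sum x al u v w N j :
    x != 0 -> al != 0 -> u * al * x ^+ N = 1 -> (j <= N)%N ->
    wph x 1 N != 0 -> wph x u N != 0 -> wph x v N != 0 -> wph x w N != 0 ->
    (forall i, (i < N)%N -> [/\ 1 - u * al * x ^+ i != 0,
       1 - v * al * x ^+ i != 0 & 1 - w * al * x ^+ i != 0]) ->
  \sum_(k < N.+1) (1 - al * x ^+ (2 * k)) * phi65_term x al u v w k
     * (poch (x ^- k) x j * poch (al * x ^+ k) x j)
  = (1 - al * x ^+ N) / al ^+ N * wph x (al * x ^+ N) N / (wph x v N * wph x w N)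
    * (poch (u * v * w * al ^+ 2 * x ^+ j) x (N - j)
       * (poch (u * al) x j * poch (v * al) x j * poch (w * al) x j)).
Proof.
move=> x0 al0 uN jN h1 hu hv hw hN; rewrite -(subKn jN).
have X0 k : x ^+ k != 0 by rewrite expf_neq0.
elim: (N - j)%N (leq_subr j N) => {j jN} [_|i IH iN].
  rewrite subn0 subnn poch0 mul1r big_ord_recr /= big1 ?add0r => [|k _]; last first.
    by rewrite poch_xV_eq0 ?ltn_ord // mul0r mulr0.
  rewrite wph_polexM poch_xV // /phi65_term !wpfE !mul1r.
  (* Since u al x^N = 1, the factor 1 - al x^(N+i+1) equals al x^N (u - x^(i+1)). *)
  have E : poch (al * x ^+ N) x N * (1 - al * x ^+ (2 * N)) =
      (1 - al * x ^+ N) * (wph x u N * (al * x ^+ N) ^+ N).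
    rewrite mul2n -addnn exprD mulrA -pochS pochSl; congr (_ * _).
    rewrite /poch /wph (expr_prod_ord (al * x ^+ N)) -big_split /=.
    by apply: eq_bigr => i _; rewrite mulrBl mulrA uN exprS; ring.
  have E2 : \prod_(i < N) (- x ^+ i.+1) =
      (x * x ^+ N) ^+ N * \prod_(i < N) (- x ^- i.+1).
    rewrite (prod_ord_rev (fun i => - x ^+ i.+1)) expr_prod_ord -big_split /=.
    apply: eq_bigr => i _; rewrite -exprS -subSn // subSS.
    apply: (mulIf (X0 i.+1)); rewrite mulrN !mulNr divfK // -exprD.
    by congr (- (_ ^+ _)); have := ltn_ord i; lia.
  rewrite E2; move: E; rewrite !exprMn exprVn !exprMn.
  move: (poch (al * _) _ _) (1 - al * x ^+ (2 * N)) => P Q E.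
  transitivity (P * Q * (\prod_(i < N) (- x ^- i.+1) * (x ^+ N / al ^+ N ^+ 2) *
    (poch al x N * poch (u * al) x N / wph x u N * (poch (v * al) x N / wph x v N) 
      * (poch (w * al) x N / wph x w N)))).
    move: (wph x 1 N) (wph x u N) (wph x v N) (wph x w N) h1 hu hv hw.
    move: (al ^+ N) (expf_neq0 N al0) => A A0.
    move: (\prod_(i < N) _) (poch al x N).
  move: (poch (u * al) x N) (poch (v * al) x N) (poch (w * al) x N).
    move=> p0 p1 p2 p3 p4 b1 b2 b3 b4 b10 b20 b30 b40.
    by field; rewrite A0 b10 b20 b30 b40.
  rewrite E.
  move: (\prod_(i < N) _) (poch al x N).
  move: (poch (u * al) x N) (poch (v * al) x N) (poch (w * al) x N).
  move: (wph x u N) (wph x v N) (wph x w N) hu hv hw => b2 b3 b4 b20 b30 b40.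
  move: (al ^+ N) (expf_neq0 N al0) => A A0 p2 p3 p4 p0 p1.
  by field; rewrite A0 b20 b30 b40.
set j := (N - i.+1)%N in IH *; have jS : (N - i)%N = j.+1 by rewrite /j; lia.
have jN : (j < N)%N by rewrite /j; lia.
have [du dv dw] := hN j jN.
have := phi65_partial j x0 al0 h1 hu hv hw.
(* At K = N the boundary term carries 1 - u al x^N = 0, which ties the sum for j to the one for
   j+1. *)
rewrite {1}uN subrr !mul0r mulr0.
set L := \sum_(k < N.+1) _ * _ * (_ * _).
move: (IH (ltnW iN)); rewrite jS; set L' := \sum_(k < N.+1) _ => E'.
have -> : forall A B, \sum_(k < N.+1) (1 - al * x ^+ (2 * k)) * phi65_term x al u v w k
    * (A * (poch (x ^- k) x j * poch (al * x ^+ k) x j)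
       - B * (poch (x ^- k) x j.+1 * poch (al * x ^+ k) x j.+1)) = A * L - B * L'.
  by move=> A B; rewrite !mulr_sumr -sumrB; apply: eq_bigr => k _; ring.
move/eqP; rewrite subr_eq0 => /eqP E.
apply: (mulfI (mulf_neq0 (mulf_neq0 du dv) dw)); rewrite {}E {}E'.
set B := u * v * w * al ^+ 2.
rewrite -[(N - j)%N](subnSK jN) (pochSl (B * _)) -[B * _ * x]mulrA -exprSr !pochS.
by rewrite !invfM; ring.
Qed.

(** The pair of factors at c and e is expanded by q-Saalschutz; after exchanging the summations, the
    inner sum over k is the 6phi5 of [phi65_sum]. *)
Lemma watson_terminating x al c e u v w N :
    x != 0 -> al != 0 -> c != 0 -> e != 0 -> u * al * x ^+ N = 1 ->
    wph x 1 N != 0 -> wph x c N != 0 -> wph x e N != 0 ->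
    wph x u N != 0 -> wph x v N != 0 -> wph x w N != 0 ->
    (forall i, (i < N)%N -> [/\ 1 - u * al * x ^+ i != 0,
       1 - v * al * x ^+ i != 0 & 1 - w * al * x ^+ i != 0]) ->
  \sum_(k < N.+1) wpg x al k * (wpf x al 1 k * wpf x al c k * wpf x al e k
     * wpf x al u k * wpf x al v k * wpf x al w k)
  = (1 - al * x ^+ N) / al ^+ N * wph x (al * x ^+ N) N / (wph x v N * wph x w N)
    * \sum_(j < N.+1) saal_coef x al c e j
        * (poch (u * v * w * al ^+ 2 * x ^+ j) x (N - j)
           * (poch (u * al) x j * poch (v * al) x j * poch (w * al) x j)).
Proof.
move=> x0 al0 c0 e0 uN h1 hc he hu hv hw hN; rewrite mulr_sumr.
transitivity (\sum_(k < N.+1) \sum_(j < N.+1) saal_coef x al c e j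
  * ((1 - al * x ^+ (2 * k)) * phi65_term x al u v w k
     * (poch (x ^- k) x j * poch (al * x ^+ k) x j))).
  apply: eq_bigr => k _; have kN : (k <= N)%N by rewrite -ltnS.
  transitivity ((1 - al * x ^+ (2 * k)) * phi65_term x al u v w k
    * (wpf x al c k * wpf x al e k * (x / al) ^+ k)).
    (* The first factor is the 6phi5 argument, the second is the one appearing in [q_saalschutz]. *)
    rewrite /wpg /phi65_term (_ : x ^+ 2 / al ^+ 3 = (x / al ^+ 2) * (x / al)).
      by rewrite exprMn; ring.
    by field.
  rewrite -q_saalschutz ?(wph_neq0_le kN) // mulr_sumr.
  (* The range j <= k is enlarged to j <= N, the new terms containing (x^(-k);x)_j = 0; the two
     ranges are then independent. *)
  rewrite [RHS](bigID (fun j : 'I_N.+1 => (j < k.+1)%N)) /= [X in _ = _ + X]big1 ?addr0.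
    rewrite -(big_ord_widen N.+1 (fun j => saal_coef x al c e j
      * ((1 - al * x ^+ (2 * k)) * phi65_term x al u v w k
        * (poch (x ^- k) x j * poch (al * x ^+ k) x j)))) //.
    by apply: eq_bigr => j _; ring.
  by move=> j; rewrite ltnS -ltnNge => kj; rewrite poch_xV_eq0 // mul0r !mulr0.
rewrite exchange_big /=; apply: eq_bigr => j _.
rewrite -mulr_sumr.
rewrite (phi65_sum x0 al0 uN (leq_ord j) h1 hu hv hw hN).
by rewrite mulrCA.
Qed.
End Transformation.

(** * Congruences over a subring of a field *)

Section Subring.
Variable F : fieldType.
Implicit Types (O : F -> Prop) (p a b x u v al c e : F).

(** O is a predicate on the field, so that divisibility by p reads O (a / p) with ordinary field
    division. *)
Record subring_pred O : Prop := SubringPred {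
  subring1 : O 1;
  subringB : forall a b, O a -> O b -> O (a - b);
  subringM : forall a b, O a -> O b -> O (a * b) }.

Variables (O : F -> Prop) (RO : subring_pred O).

Lemma subring0 : O 0. Proof. by rewrite -(subrr 1);
  exact: (subringB RO (subring1 RO) (subring1 RO)). Qed.
Lemma subringN a : O a -> O (- a).
Proof. by rewrite -sub0r => oa; exact: (subringB RO subring0 oa). Qed.
Lemma subringD a b : O a -> O b -> O (a + b).
Proof. by move=> oa ob; rewrite -[b]opprK; exact: (subringB RO oa (subringN ob)). Qed.
Lemma subringX a k : O a -> O (a ^+ k).
Proof. by move=> oa; elim: k => [|k IH]; rewrite ?exprS;
  [exact: (subring1 RO) | exact: (subringM RO)]. Qed.
Lemma subring_nat k : O k%:R.
Proof. by elim: k => [|k IH]; rewrite ?mulrS;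
  [exact: subring0 | exact: (subringD (subring1 RO) IH)]. Qed.
Lemma subring_sum k (G : 'I_k -> F) : (forall i, O (G i)) -> O (\sum_(i < k) G i).
Proof. by move=> h; apply: big_ind => //; [apply: subring0 | apply: subringD]. Qed.
Lemma subring_prod k (G : 'I_k -> F) : (forall i, O (G i)) -> O (\prod_(i < k) G i).
Proof. by move=> h; apply: big_ind => //; [exact: (subring1 RO) | exact: (subringM RO)]. Qed.

Lemma subringMl a b c : O b -> O (a / c) -> O (a * b / c).
Proof. by rewrite mulrAC => ob oa; exact: (subringM RO). Qed.

Lemma subring_poch a x k : O a -> O x -> O (poch a x k).
Proof.
move=> oa ox; apply: subring_prod => i; apply: (subringB RO); first exact: (subring1 RO).
by apply: (subringM RO) => //; apply: subringX.
Qed.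

Variable p : F.
Hypothesis p0 : p != 0.

Definition eqm a b := O ((a - b) / p).

Lemma eqm_refl a : eqm a a.
Proof. by rewrite /eqm subrr mul0r; apply: subring0. Qed.
Lemma eqm_sym a b : eqm a b -> eqm b a.
Proof. by rewrite /eqm => /subringN; rewrite -mulNr opprB. Qed.
Lemma eqm_trans b a c : eqm a b -> eqm b c -> eqm a c.
Proof.
rewrite /eqm => h1 h2; have := subringD h1 h2.
by rewrite -mulrDl [_ - b + _]addrA addrNK.
Qed.
Lemma eqm_D a b a' b' : eqm a a' -> eqm b b' -> eqm (a + b) (a' + b').
Proof.
rewrite /eqm => h1 h2; have := subringD h1 h2; rewrite -mulrDl.
by rewrite (_ : a - a' + (b - b') = a + b - (a' + b')) //; ring.
Qed.
Lemma eqm_B a b a' b' : eqm a a' -> eqm b b' -> eqm (a - b) (a' - b').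
Proof.
rewrite /eqm => h1 h2; have := subringB RO h1 h2; rewrite -mulrBl.
by rewrite (_ : a - a' - (b - b') = a - b - (a' - b')) //; ring.
Qed.
Lemma eqm_M a b a' b' : O a -> O b' -> eqm a a' -> eqm b b' -> eqm (a * b) (a' * b').
Proof.
rewrite /eqm => oa ob h1 h2.
have := subringD (subringM RO oa h2) (subringM RO ob h1); rewrite !mulrA -mulrDl.
by rewrite (_ : a * (b - b') + b' * (a - a') = a * b - a' * b') //; ring.
Qed.
Lemma eqm_V a a' : a != 0 -> a' != 0 -> O a^-1 -> O a'^-1 -> eqm a a' -> eqm a^-1 a'^-1.
Proof.
rewrite /eqm => a0 a0' oa oa' h.
have := subringM RO (subringN (subringM RO oa oa')) h.
by rewrite (_ : - (a^-1 / a') * ((a - a') / p) = (a^-1 - a'^-1) / p) //; field;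
  rewrite p0 a0 a0'.
Qed.
Lemma eqm_prod k (G H : 'I_k -> F) : (forall i, O (G i)) -> (forall i, O (H i)) ->
  (forall i, eqm (G i) (H i)) -> eqm (\prod_(i < k) G i) (\prod_(i < k) H i).
Proof.
move=> oG oH h.
suff [] : [/\ eqm (\prod_(i < k) G i) (\prod_(i < k) H i), O (\prod_(i < k) G i)
  & O (\prod_(i < k) H i)] by [].
apply: (big_ind2 (fun a b => [/\ eqm a b, O a & O b])) => [|a b a' b' [h1 h2 h3] [h4 h5 h6]|//].
  by split; [exact: eqm_refl | exact: (subring1 RO) | exact: (subring1 RO)].
by split; [exact: eqm_M | exact: (subringM RO) | exact: (subringM RO)].
Qed.
Lemma eqm_sum k (G H : 'I_k -> F) :
  (forall i, eqm (G i) (H i)) -> eqm (\sum_(i < k) G i) (\sum_(i < k) H i).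
Proof.
by move=> h; apply: (big_ind2 eqm) => // [|*]; [apply: eqm_refl | apply: eqm_D].
Qed.
Lemma eqm_X a b k : O a -> O b -> eqm a b -> eqm (a ^+ k) (b ^+ k).
Proof. by move=> oa ob h; rewrite !expr_prod_ord; apply: eqm_prod. Qed.
Lemma eqm0 a : O (a / p) -> eqm a 0. Proof. by rewrite /eqm subr0. Qed.
Lemma eqm0P a : eqm a 0 -> O (a / p). Proof. by rewrite /eqm subr0. Qed.

End Subring.

Ltac subring_tac R :=
  repeat first [ assumption | apply: (subring1 R) | apply: (subring0 R) | apply: (subring_nat R)
    | apply: (subringD R) | apply: (subringB R) | apply: (subringN R) | apply: (subringM R)
    | apply: (subringX R)].

(** * Reversal of the well-poised sum *)

Section Antisymmetry.
Variables (F : fieldType) (O : F -> Prop) (RO : subring_pred O) (p : F).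
Hypothesis p0 : p != 0.
Variables (x : F) (s : nat).
Hypotheses (x0 : x != 0) (Ox : O x) (OxV : O x^-1).
Local Notation "a ≡ b" := (eqm O p a b) (at level 70).

(** At al = x^(-s) the numerator is, up to signs and powers of x, the product of the last k factors
    of [wph x z s]. What remains looks like a Gaussian binomial, invariant under k -> s-k. *)
Lemma wpf_reflect z k : (k <= s)%N -> wph x z s != 0 ->
  wpf x (x ^- s) z k = \prod_(i < k) (- (x ^+ i / x ^+ s))
    * (wph x z s / (wph x z k * wph x z (s - k))).
Proof.
move=> ks hs.
have h j : (j <= s)%N -> wph x z j != 0 by move=> js; apply: wph_neq0_le hs.
have X0 j : x ^+ j != 0 by rewrite expf_neq0.
rewrite wpfE; have -> : poch (z / x ^+ s) x k =
  \prod_(i < k) (- (x ^+ i / x ^+ s)) * \prod_(i < k) (z - x ^+ (s - i)).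
  rewrite /poch -big_split; apply: eq_bigr => i _ /=.
  have -> : x ^+ s = x ^+ i * x ^+ (s - i) by rewrite -exprD subnKC //; have := ltn_ord i; lia.
  by field; rewrite !X0.
suff -> : wph x z s = wph x z (s - k) * \prod_(i < k) (z - x ^+ (s - i)).
  by field; rewrite !h // leq_subr.
elim: k ks {h} => [|k IH] ks; first by rewrite subn0 big_ord0 mulr1.
have E : wph x z (s - k) = wph x z (s - k.+1) * (z - x ^+ (s - k)).
  by rewrite -{1}(subnSK ks) wphS subnSK.
by rewrite (IH (ltnW ks)) E big_ord_recr /= -mulrA [X in _ * X]mulrC.
Qed.

(* The quantity [e^2] with [e = prod (- x^i/x^s)] is [x^(k^2-k-2sk)]. *)
Lemma wpg_reflect k j : (k + j)%N = s ->
  (\prod_(i < k) (- (x ^+ i / x ^+ s))) ^+ 6 * wpg x (x ^- s) k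
    = (x ^- k - x ^- j) / x ^+ (3 * (k * j)).
Proof.
move=> ks; have X0 i : x ^+ i != 0 by rewrite expf_neq0.
have E i : (\prod_(l < i) (- (x ^+ l / x ^+ s))) ^+ 2
    = x ^+ (i * i) / (x ^+ i * x ^+ (s * i) ^+ 2).
  elim: i => [|i IH]; first by rewrite big_ord0 !muln0 !expr0 expr1n mulr1 divr1.
  rewrite big_ord_recr /= exprMn {}IH mulSn !mulnS !exprD !exprS.
  by field; rewrite !X0 x0.
rewrite (exprM _ 2 3) E /wpg exprVn invrK -ks !(mulnC _ k) !mulnDr -!exprM.
have -> : (x ^+ 2 * x ^+ ((k + j) * 3)) ^+ k
    = x ^+ k ^+ 2 * (x ^+ (k * k) * x ^+ (k * j)) ^+ 3.
  by rewrite exprMn -[x ^+ (k * k) * _]exprD -!exprM -!exprD; congr (_ ^+ _); lia.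
rewrite (mulnC k 2) mul2n -addnn (mulnC 3) (exprM _ (_ + _)%N 2) (exprM _ _ 3) !exprD.
move: (X0 (k * k)%N) (X0 (k * j)%N) (X0 k) (X0 j).
move: (x ^+ (k * k)) (x ^+ (k * j)) (x ^+ k) (x ^+ j) => A B X J hA hB hX hJ.
by field; rewrite hA hB hX hJ.
Qed.

Variables (al c e : F) (y : nat -> F).
Hypotheses (Oal : O al) (OalV : O al^-1) (al0 : al != 0) (Ec : O c) (Ee : O e).
Hypothesis als : O ((al * x ^+ s - 1) / p).
Hypothesis unit_z : forall z i, z \in [:: 1; c; e] -> (0 < i <= s)%N ->
  z - x ^+ i != 0 /\ O (z - x ^+ i)^-1.
Hypothesis y_sym : forall k, (k <= s)%N -> y k ≡ y (s - k)%N.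
Hypothesis Oy : forall k, (k <= s)%N -> O (y k).
Hypotheses (two0 : (2%:R : F) != 0) (O2V : O (2%:R^-1)).

Definition wterm xx all cc ee k : F :=
  wpg xx all k * (wpf xx all 1 k ^+ 4 * wpf xx all cc k * wpf xx all ee k).

Lemma OxVn k : O (x ^- k). Proof. by rewrite -exprVn; apply: subringX. Qed.

Lemma z_int z : z \in [:: 1; c; e] -> O z.
Proof. by rewrite !inE => /or3P[] /eqP -> //; apply: (subring1 RO). Qed.

Lemma wpf_int b z k : z \in [:: 1; c; e] -> O b -> (k <= s)%N -> O (wpf x b z k).
Proof.
move=> hz Ob ks; apply: subring_prod => // i.
have [|_ ?] := unit_z (i := i.+1) hz; first by have := ltn_ord i; lia.
by have := z_int hz => ?; subring_tac RO.
Qed.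

Lemma eqm_alpha : al ≡ x ^- s.
Proof.
have X0 : x ^+ s != 0 by rewrite expf_neq0.
have := subringM RO als (OxVn s); rewrite /eqm.
by rewrite (_ : _ * _ = (al - x ^- s) / p) //; field; rewrite p0 X0.
Qed.

Lemma eqm_wpf z k : z \in [:: 1; c; e] -> (k <= s)%N -> wpf x al z k ≡ wpf x (x ^- s) z k.
Proof.
move=> hz ks; have Oz := z_int hz; have OV := OxVn s.
have h (i : 'I_k) : O (z - x ^+ i.+1)^-1.
  by have [|_ ?] := unit_z (i := i.+1) hz; first by have := ltn_ord i; lia.
apply: eqm_prod => // i; have ? := h i; [by subring_tac RO | by subring_tac RO |].
apply: eqm_M => //; [by subring_tac RO | | exact: eqm_refl].
apply: eqm_B => //; first exact: eqm_refl.
apply: eqm_M => //; [by subring_tac RO | by subring_tac RO | | exact: eqm_refl].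
by apply: eqm_M => //; [exact: eqm_refl | exact: eqm_alpha].
Qed.

Lemma wpg_int b k : O b -> O b^-1 -> O (wpg x b k).
Proof. by move=> Ob ObV; rewrite /wpg -exprVn; subring_tac RO. Qed.

Lemma eqm_wpg k : wpg x al k ≡ wpg x (x ^- s) k.
Proof.
have OV := OxVn s; have OV' : O (x ^- s)^-1 by rewrite invrK; apply: subringX.
have X0 : x ^- s != 0 by rewrite invr_eq0 expf_neq0.
rewrite /wpg; apply: eqm_M => //; first by subring_tac RO.
- by rewrite -exprVn; subring_tac RO.
- apply: eqm_B => //; first exact: eqm_refl.
  by apply: eqm_M => //; [subring_tac RO | exact: eqm_alpha | exact: eqm_refl].
have OV3 : O (al ^- 3) by rewrite -exprVn; apply: subringX.
have OV3' : O (x ^- s ^- 3) by rewrite -exprVn; apply: subringX.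
apply: eqm_X => //; [by subring_tac RO | by subring_tac RO |].
apply: eqm_M => //; [by subring_tac RO | exact: eqm_refl |].
apply: eqm_V => //; [by rewrite expf_neq0 | by rewrite expf_neq0 |].
by apply: eqm_X => //; exact: eqm_alpha.
Qed.

Lemma wterm_int b k : O b -> O b^-1 -> (k <= s)%N -> O (wterm x b c e k).
Proof.
move=> Ob ObV ks; rewrite /wterm; have := wpg_int k Ob ObV.
have := @wpf_int b 1 k _ Ob ks; have := @wpf_int b c k _ Ob ks.
have := @wpf_int b e k _ Ob ks; rewrite !inE !eqxx ?orbT => /(_ isT) ? /(_ isT) ? /(_ isT) ? ?.
by subring_tac RO.
Qed.

Lemma eqm_wterm k : (k <= s)%N -> wterm x al c e k ≡ wterm x (x ^- s) c e k.
Proof.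
move=> ks; have OV := OxVn s; have OV' : O (x ^- s)^-1 by rewrite invrK; apply: subringX.
have m1 : 1 \in [:: 1; c; e] by rewrite inE eqxx.
have mc : c \in [:: 1; c; e] by rewrite !inE eqxx orbT.
have me : e \in [:: 1; c; e] by rewrite !inE eqxx !orbT.
have Z z : z \in [:: 1; c; e] ->
    [/\ O (wpf x al z k), O (wpf x (x ^- s) z k) & wpf x al z k ≡ wpf x (x ^- s) z k].
  by move=> hz; split; [apply: wpf_int | apply: wpf_int | apply: eqm_wpf].
have [? ? ?] := Z _ m1; have [? ? ?] := Z _ mc; have [? ? ?] := Z _ me.
have := wpg_int k Oal OalV; have := wpg_int k OV OV' => ? ?.
rewrite /wterm; apply: eqm_M => //; [by subring_tac RO | exact: eqm_wpg |].
apply: eqm_M => //; first by subring_tac RO.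
by apply: eqm_M => //; [subring_tac RO | exact: eqm_X].
Qed.

(** Four factors at 1 and one each at c and e supply the sixth power in [wpg_reflect], whose value
    changes sign when k and s-k are exchanged. *)
Lemma wterm_antisym k : (k <= s)%N ->
  wterm x (x ^- s) c e (s - k) = - wterm x (x ^- s) c e k.
Proof.
move=> ks; have ks' := leq_subr k s.
have h z : z \in [:: 1; c; e] -> wph x z s != 0.
  by move=> hz; apply: wph_neq0 => i hi; case: (unit_z hz hi).
have m1 := h 1 (mem_head _ _).
have mc : wph x c s != 0 by apply: h; rewrite !inE eqxx orbT.
have me : wph x e s != 0 by apply: h; rewrite !inE eqxx !orbT.
rewrite /wterm !wpf_reflect // subKn //.
have EQ := wpg_reflect (subnK ks); have EP := wpg_reflect (subnKC ks).
move: EP EQ; set P := \prod_(i < k) _; set Q := \prod_(i < s - k) _ => EP EQ.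
have {EP EQ} E : Q ^+ 6 * wpg x (x ^- s) (s - k) = - (P ^+ 6 * wpg x (x ^- s) k).
  by rewrite EP EQ (mulnC k) -mulNr opprB.
set G := (wph x 1 s / (wph x 1 k * wph x 1 (s - k))) ^+ 4
  * (wph x c s / (wph x c k * wph x c (s - k)))
  * (wph x e s / (wph x e k * wph x e (s - k))).
transitivity (Q ^+ 6 * wpg x (x ^- s) (s - k) * G).
  by rewrite /G !invfM; ring.
by rewrite E /G !invfM; ring.
Qed.

(** Modulo p, al may be replaced by x^(-s); reversing the sum S then gives that 2S vanishes. The
    symmetric weight y is 1 for [wterm_low_sum] and the cube of [ell] for [wquo_sum]. *)
Lemma wterm_sum_antisym : O ((\sum_(k < s.+1) wterm x al c e k * y k) / p).
Proof.
have OV := OxVn s; have OV' : O (x ^- s)^-1 by rewrite invrK; apply: subringX.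
apply: eqm0P; apply: (@eqm_trans _ _ RO _ (\sum_(k < s.+1) wterm x (x ^- s) c e k * y k)).
  apply: eqm_sum => // k; have ks := leq_ord k.
  apply: eqm_M => //; [exact: wterm_int | exact: Oy | exact: eqm_wterm | exact: eqm_refl].
set S := \sum_(k < _) _.
have E : S + S = \sum_(k < s.+1) wterm x (x ^- s) c e k * (y k - y (s - k)%N).
  rewrite {2}/S (reindex_inj rev_ord_inj) /= -big_split; apply: eq_bigr => k _ /=.
  by rewrite subSS (wterm_antisym (leq_ord k)) mulrBr mulNr.
rewrite /eqm subr0 (_ : S = 2%:R^-1 * (S + S)); last first.
  by rewrite -mulr2n -(mulr_natl S) mulKf.
rewrite E -mulrA; apply: (subringM RO) => //; rewrite mulr_suml.
apply: subring_sum => // k; rewrite -mulrA; apply: (subringM RO).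
  exact: (wterm_int OV OV' (leq_ord k)).
exact: (y_sym (leq_ord k)).
Qed.
End Antisymmetry.

(** * Zeros and poles at a divisor of n *)

Lemma pochD (F : fieldType) (a x : F) k l :
  poch a x (k + l) = poch a x k * poch (a * x ^+ k) x l.
Proof.
rewrite /poch big_split_ord; congr (_ * _); apply: eq_bigr => i _ /=.
by rewrite exprD mulrA.
Qed.

Record qgeneric (F : fieldType) (q c e : F) : Prop := QGeneric {
  qg_q0 : q != 0;
  qg_c0 : c != 0;
  qg_e0 : e != 0;
  qg_q : forall j, (0 < j)%N -> 1 - q ^+ j != 0;
  qg_c : forall j, c - q ^+ j != 0;
  qg_e : forall j, e - q ^+ j != 0;
  qg_2 : (2%:R : F) != 0 }.

(* An abstraction of the local ring of K[q] at the cyclotomic polynomial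
   [Phi_m]; its maximal ideal is generated by [1 - q^m]. *)
Record qplace (F : fieldType) (q c e : F) (m : nat) (O : F -> Prop) : Prop := QPlace {
  qp_ring : subring_pred O;
  qp_q : O q;
  qp_qV : O q^-1;
  qp_c : O c;
  qp_cV : O c^-1;
  qp_e : O e;
  qp_eV : O e^-1;
  qp_2V : O (2%:R^-1);
  qp_unit : forall j, ~~ (m %| j)%N -> O (1 - q ^+ j)^-1;
  qp_quot : forall j, (0 < j)%N -> (m %| j)%N -> O ((1 - q ^+ m) / (1 - q ^+ j));
  qp_cq : forall j, O (c - q ^+ j)^-1;
  qp_eq : forall j, O (e - q ^+ j)^-1 }.

(** Among m consecutive factors 1 - q^(A+di), one has its exponent divisible by m. *)
Lemma solve_linear_mod (d m : nat) (A : int) : coprime d m -> (0 < m)%N ->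
  exists2 i, (i < m)%N & (m %| A + (d * i)%:Z)%Z.
Proof.
move=> dm m0; have [u [v uv]] := Bezoutz d m.
have {}uv : u * d + v * m = 1 by rewrite uv /gcdz /= (eqP dm).
have m0' : (m%:Z : int) != 0 by lia.
(* The Bezout coefficient u is an inverse of d modulo m. *)
exists `|((- A * u) %% m)%Z|%N.
  by have := ltz_pmod (- A * u) (d := m) ltac:(lia); have := modz_ge0 (- A * u) m0'; lia.
have -> : A + (d * `|((- A * u) %% m)%Z|)%:Z = A + d%:Z * ((- A * u) %% m)%Z.
  by rewrite PoszM gez0_abs ?modz_ge0.
have := divz_eq (- A * u) m; set Q := (_ %/ _)%Z; set R := (_ %% _)%Z => E.
apply/dvdzP; exists (A * v - d%:Z * Q).
have -> : R = - A * u - Q * m by rewrite E; ring.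
transitivity (A * (1 - u * d) - d%:Z * Q * m); first by ring.
by rewrite -uv; ring.
Qed.

Section Place.
Variables (F : fieldType) (q c e : F) (m : nat) (O : F -> Prop).
Hypotheses (qG : qgeneric q c e) (qP : qplace q c e m O) (m1 : (1 < m)%N).
Let RO := qp_ring qP.
Let m0 : (0 < m)%N := ltnW m1.
Let q0 := qg_q0 qG.
Local Notation pi := (1 - q ^+ m).

Lemma pi_neq0 : pi != 0. Proof. exact: (qg_q qG m0). Qed.
Lemma pi_int : O pi.
Proof. by apply: (subringB RO); [exact: (subring1 RO) | apply: (subringX RO);
  exact: qp_q qP]. Qed.

Lemma qz_int (A : int) : O (q ^ A).
Proof.
case: A => k; first by rewrite -exprnP; apply: (subringX RO); exact: qp_q qP.
by rewrite NegzE -exprnN -exprVn; apply: (subringX RO); exact: qp_qV qP.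
Qed.

Lemma onemqzN (j : nat) : 1 - q ^ (- j%:Z) = - q ^- j * (1 - q ^+ j).
Proof. by rewrite -exprnN; field; rewrite expf_neq0. Qed.

Lemma qz_neq0 (A : int) : A != 0 -> 1 - q ^ A != 0.
Proof.
case: A => k hk; first by rewrite -exprnP; apply: (qg_q qG); lia.
by rewrite NegzE onemqzN mulf_neq0 ?oppr_eq0 ?invr_eq0 ?expf_neq0 ?(qg_q qG).
Qed.

Lemma qz_dvd (A : int) : (m %| A)%Z -> O ((1 - q ^ A) / pi).
Proof.
have H k : (m %| k)%N -> O ((1 - q ^+ k) / pi).
  move=> /dvdnP[b ->]; rewrite mulnC exprM -opprB subrX1 -mulNr opprB.
  rewrite mulrAC divff ?pi_neq0 // mul1r; apply: (subring_sum RO) => i.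
  by do 2!apply: (subringX RO); exact: qp_q qP.
case: A => k hk; first by rewrite -exprnP; apply: H.
rewrite NegzE onemqzN -mulrA; apply: (subringM RO); last exact: H.
by rewrite -exprVn; apply: (subringN RO); apply: (subringX RO); exact: qp_qV qP.
Qed.

Lemma qz_mod (A B : int) : (m %| A - B)%Z -> eqm O pi (q ^ A) (q ^ B).
Proof.
move=> h; have := subringM RO (qz_int B) (qz_dvd h); rewrite mulrA mulrBr mulr1.
rewrite -expfzDr // [B + _]addrC subrK => /(subringN RO).
by rewrite -mulNr opprB.
Qed.

Variables (d : nat) (r : int).
Hypothesis (dm : coprime d m).
Local Notation x := (q ^+ d).
Local Notation al := (q ^ r).

Lemma xE i : x ^+ i = q ^ (d * i)%N. Proof. by rewrite -exprM exprnP. Qed.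
Lemma qx (A : int) i : q ^ A * x ^+ i = q ^ (A + (d * i)%N).
Proof. by rewrite xE -expfzDr. Qed.

Lemma d_gt0 : (0 < d)%N.
Proof. by case: d dm => //; rewrite /coprime gcd0n; lia. Qed.

Lemma x_int : O x. Proof. by apply: (subringX RO); exact: qp_q qP. Qed.
Lemma xV_int : O x^-1. Proof. by rewrite -exprVn; apply: (subringX RO); exact: qp_qV qP. Qed.
Lemma alV_int : O al^-1. Proof. by rewrite invr_expz; exact: qz_int. Qed.
Lemma x_neq0 : x != 0. Proof. exact: expf_neq0. Qed.
Lemma al_neq0 : al != 0. Proof. exact: expfz_neq0. Qed.

Lemma poch_full_block (A : int) : O (poch (q ^ A) x m / pi).
Proof.
have [i im hi] := solve_linear_mod A dm m0.
rewrite /poch (bigD1 (Ordinal im)) //= qx; apply: (subringMl RO).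
  apply: big_ind => [|a b|j _]; [exact: (subring1 RO) | exact: (subringM RO) |].
  by rewrite qx; apply: (subringB RO) (qz_int _); exact: (subring1 RO).
exact: qz_dvd.
Qed.

Lemma poch_int (A : int) k : O (poch (q ^ A) x k).
Proof. by apply: (subring_poch RO); [exact: qz_int | exact: x_int]. Qed.

(** One zero for each complete block of m consecutive factors. *)
Lemma poch_pi (A : int) L : O (poch (q ^ A) x L / pi ^+ (L %/ m)).
Proof.
rewrite {1}(divn_eq L m); elim: (L %/ m)%N A => [|b IH] A.
  by rewrite mul0n expr0 divr1; apply: poch_int.
rewrite mulSn -addnA pochD qx exprS invfM mulrACA.
by apply: (subringM RO); [exact: poch_full_block | exact: IH].
Qed.

(** The opposite bound for (x;x)_k: as d is prime to m, only the factors with index divisible by m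
    fail to be units. With [poch_pi] it shows that [wpf x al 1 k] has no pole. *)
Lemma pochV_pi k : O (pi ^+ (k %/ m) / poch x x k).
Proof.
elim: k => [|k IH]; first by rewrite div0n expr0 poch0 divr1; exact: (subring1 RO).
have -> : pi ^+ (k.+1 %/ m) / poch x x k.+1
    = pi ^+ (k %/ m) / poch x x k * (pi ^+ (m %| k.+1) / (1 - q ^+ (d * k.+1))).
  by rewrite divnS // pochS -exprS -exprM exprD invfM; ring.
apply: (subringM RO) => //; have d0 := d_gt0.
have E : (m %| d * k.+1)%N = (m %| k.+1)%N by rewrite Gauss_dvdr // coprime_sym.
case hk: (m %| k.+1)%N.
  by apply: (qp_quot qP); rewrite ?E // muln_gt0 d0.
by rewrite expr0 mul1r; apply: (qp_unit qP); rewrite E hk.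
Qed.

Variables (M n : nat).
Hypotheses (rM : r + (d * M)%:Z = n%:Z) (mn : (m %| n)%N) (n0 : (0 < n)%N).
Local Notation s := (M %% m)%N.

(** As r + dM = n is 0 modulo m, the zeros among the factors 1 - al x^i are at the i congruent to M,
    hence at remainder s. *)
Lemma dvd_alx i : (m %| r + (d * i)%:Z)%Z = (m %| M%:Z - i%:Z)%Z.
Proof.
have -> : r + (d * i)%:Z = n%:Z - d%:Z * (M%:Z - i%:Z) by rewrite -rM !PoszM; ring.
by rewrite rpredBl // Gauss_dvdzr // coprimezE /= coprime_sym.
Qed.

Lemma alx_pi i : (m %| M%:Z - i%:Z)%Z -> O ((1 - al * x ^+ i) / pi).
Proof. by move=> h; rewrite qx; apply: qz_dvd; rewrite dvd_alx. Qed.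

Lemma xi_unit i : ~~ (m %| i)%N -> O (1 - x ^+ i)^-1.
Proof.
by move=> h; rewrite -exprM; apply: (qp_unit qP); rewrite Gauss_dvdr // coprime_sym.
Qed.

Lemma xi_neq0 i : (0 < i)%N -> 1 - x ^+ i != 0.
Proof. by move=> h; rewrite -exprM (qg_q qG) // muln_gt0 d_gt0. Qed.

Lemma wph1E k : wph x 1 k = poch x x k.
Proof. by apply: eq_bigr => i _; rewrite exprS. Qed.

Lemma wpf1E k : wpf x al 1 k = poch al x k / poch x x k.
Proof. by rewrite wpfE mul1r wph1E. Qed.

Lemma wpf1_int k : O (wpf x al 1 k).
Proof.
rewrite wpf1E; have := subringM RO (poch_pi r k) (pochV_pi k).
by rewrite mulrA divfK // expf_neq0 // pi_neq0.
Qed.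

(** The incomplete last block already contains the index of remainder s, which gives one zero beyond
    the complete blocks. *)
Lemma poch_al_pi k : (s < k %% m)%N -> O (poch al x k / pi ^+ (k %/ m).+1).
Proof.
move=> sk; rewrite {1}(divn_eq k m) pochD qx exprSr invfM mulrACA.
apply: (subringM RO); first by have := poch_pi r (k %/ m * m); rewrite mulnK.
rewrite /poch (bigD1 (Ordinal sk)) //= qx; apply: (subringMl RO).
  apply: big_ind => [|a b|j _]; [exact: (subring1 RO) | exact: (subringM RO) |].
  by rewrite qx; apply: (subringB RO) (qz_int _); exact: (subring1 RO).
apply: qz_dvd; rewrite -addrA -PoszD -mulnDr dvd_alx.
apply/dvdzP; exists ((M %/ m)%:Z - (k %/ m)%:Z); rewrite {1}(divn_eq M m).
by rewrite !PoszD !PoszM; ring.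
Qed.

Lemma wpf1_pi k : (s < k %% m)%N -> O (wpf x al 1 k / pi).
Proof.
move=> sk; rewrite wpf1E; have := subringM RO (poch_al_pi sk) (pochV_pi k).
have P0 : pi ^+ (k %/ m) != 0 by rewrite expf_neq0 // pi_neq0.
rewrite exprS; move: (pi ^+ _) P0 => P P0 h.
rewrite (_ : _ / _ = poch al x k / (pi * P) * (P / poch x x k)) //.
by rewrite invfM -[LHS](mulVKf P0); ring.
Qed.

Lemma wpfz_int z a k : O z -> O a -> (forall i, (0 < i <= k)%N -> O (z - x ^+ i)^-1) ->
  O (wpf x a z k).
Proof.
move=> Oz Oa h; apply: (subring_prod RO) => i; have Ox := x_int.
have : O (z - x ^+ i.+1)^-1 by apply: h; rewrite /= ltn_ord.
by move=> ?; subring_tac RO.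
Qed.

Lemma wpfcE_int z k : z = c \/ z = e -> O (wpf x al z k).
Proof.
move=> h; apply: wpfz_int.
- by case: h => ->; [exact: (qp_c qP) | exact: (qp_e qP)].
- exact: qz_int.
- by move=> i _; rewrite -exprM; case: h => ->; [exact: (qp_cq qP) | exact: (qp_eq qP)].
Qed.

Lemma wpg_O k : O (wpg x al k).
Proof.
have := x_int; have := qz_int r; have := alV_int => ? ? ?.
by rewrite /wpg -exprVn; subring_tac RO.
Qed.

Lemma wpf_split z a t : wpf x al z (a + t) = wpf x al z a
  * \prod_(i < t) ((1 - z * al * x ^+ (a + i)) / (z - x ^+ (a + i).+1)).
Proof. exact: big_split_ord. Qed.

Lemma xm_mod b i : eqm O pi (x ^+ (b * m + i)) (x ^+ i).
Proof.
rewrite !xE; apply: qz_mod; apply/dvdzP; exists (d%:Z * b%:Z).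
by rewrite !PoszM PoszD PoszM; ring.
Qed.

Lemma unit_pl z i : z \in [:: 1; c; e] -> (0 < i < m)%N ->
  z - x ^+ i != 0 /\ O (z - x ^+ i)^-1.
Proof.
move=> + /andP[i0 im]; rewrite !inE => /or3P[] /eqP ->.
- by split; [exact: xi_neq0 | apply: xi_unit; rewrite gtnNdvd].
- by rewrite -exprM; split; [exact: (qg_c qG) | exact: (qp_cq qP)].
- by rewrite -exprM; split; [exact: (qg_e qG) | exact: (qp_eq qP)].
Qed.

Lemma pl_int z : z \in [:: 1; c; e] -> O z.
Proof.
by rewrite !inE => /or3P[] /eqP ->; [exact: (subring1 RO)|exact: (qp_c qP)|exact: (qp_e qP)].
Qed.

Lemma als_mod : O ((al * x ^+ s - 1) / pi).
Proof.
rewrite -opprB mulNr; apply: (subringN RO); apply: alx_pi.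
by apply/dvdzP; exists (M %/ m)%:Z; rewrite {1}(divn_eq M m) PoszD addrK PoszM.
Qed.

Lemma wterm_low_sum : O ((\sum_(k < s.+1) wterm x al c e k) / pi).
Proof.
have sm : (s < m)%N by rewrite ltn_mod.
rewrite (eq_bigr (fun k : 'I_s.+1 => wterm x al c e k * 1)) => [|k _]; last by rewrite mulr1.
apply: (@wterm_sum_antisym _ _ RO _ pi_neq0 x s x_neq0 x_int xV_int al c e (fun=> 1)).
- exact: qz_int.
- exact: alV_int.
- exact: al_neq0.
- exact: (qp_c qP).
- exact: (qp_e qP).
- exact: als_mod.
- by move=> z i hz /andP[i0 i_s]; apply: unit_pl => //; rewrite i0 (leq_ltn_trans i_s).
- by move=> k _; apply: (eqm_refl RO).
- by move=> k _; exact: (subring1 RO).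
- exact: (qg_2 qG).
- exact: (qp_2V qP).
Qed.

(** Since x^m is 1 modulo [pi], block b repeats block 0 up to a factor Z independent of t. Z
    collects the products up to bm, where zeros and poles may cancel, so its integrality comes from
    [wpf1_int]. *)
Lemma wterm_shift b : exists2 Z, O Z & forall t, (t <= s)%N ->
  eqm O pi (wterm x al c e (b * m + t)) (Z * wterm x al c e t).
Proof.
have sm : (s < m)%N by rewrite ltn_mod.
have ? := x_int; have ? := qz_int r; have ? := alV_int.
have ? : O (al ^- 3) by rewrite -exprVn; subring_tac RO.
set Z := (x ^+ 2 / al ^+ 3) ^+ (b * m) * (wpf x al 1 (b * m) ^+ 4
  * wpf x al c (b * m) * wpf x al e (b * m)).
have OZ : O Z.
  have ? := wpf1_int (b * m); have ? := @wpfcE_int c (b * m) (or_introl erefl).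
  by have ? := @wpfcE_int e (b * m) (or_intror erefl); rewrite /Z; subring_tac RO.
exists Z => // t ts.
(* The part of [wpf] beyond bm; its denominator indices lie strictly between bm and (b+1)m, so they
   are units. *)
set V := fun z => \prod_(i < t) ((1 - z * al * x ^+ (b * m + i)) / (z - x ^+ (b * m + i).+1)).
have hV z : z \in [:: 1; c;
  e] -> [/\ O (V z), O (wpf x al z t) & eqm O pi (V z) (wpf x al z t)].
  move=> hz; have Oz := pl_int hz; have Ox := x_int; have Oal := qz_int r.
  have h1 (i : 'I_t) : z - x ^+ i.+1 != 0 /\ O (z - x ^+ i.+1)^-1.
    by apply: unit_pl => //; have := ltn_ord i; lia.
  have h2 (i : 'I_t) : z - x ^+ (b * m + i).+1 != 0 /\ O (z - x ^+ (b * m + i).+1)^-1.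
    move: hz; rewrite !inE => /or3P[] /eqP ->.
    - split; [exact: xi_neq0 | apply: xi_unit].
      by rewrite -addnS dvdn_addr ?dvdn_mull // gtnNdvd //; have := ltn_ord i; lia.
    - by rewrite -exprM; split; [exact: (qg_c qG) | exact: (qp_cq qP)].
    - by rewrite -exprM; split; [exact: (qg_e qG) | exact: (qp_eq qP)].
  have o1 (i : 'I_t) : O ((1 - z * al * x ^+ (b * m + i)) / (z - x ^+ (b * m + i).+1)).
    by have [_ ?] := h2 i; subring_tac RO.
  have o2 (i : 'I_t) : O ((1 - z * al * x ^+ i) / (z - x ^+ i.+1)).
    by have [_ ?] := h1 i; subring_tac RO.
  split; [exact: (subring_prod RO) | exact: (subring_prod RO) | apply: (eqm_prod RO) => // i].
  have [n1 ?] := h1 i; have [n2 ?] := h2 i.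
  apply: (eqm_M RO) => //; [by subring_tac RO | |].
    apply: (eqm_B RO); [exact: (eqm_refl RO) | apply: (eqm_M RO); last exact: xm_mod].
    - by subring_tac RO.
    - by subring_tac RO.
    - exact: (eqm_refl RO).
  apply: (eqm_V RO) => //; first exact: pi_neq0.
  by apply: (eqm_B RO); [exact: (eqm_refl RO) | rewrite -addnS; exact: xm_mod].
have m_1 : 1 \in [:: 1; c; e] by rewrite inE eqxx.
have mc : c \in [:: 1; c; e] by rewrite !inE eqxx orbT.
have me : e \in [:: 1; c; e] by rewrite !inE eqxx !orbT.
have [? ? ?] := hV _ m_1; have [? ? ?] := hV _ mc; have [? ? ?] := hV _ me.
have -> : wterm x al c e (b * m + t) = Z * ((1 - al * x ^+ (2 * (b * m + t)))
   * (x ^+ 2 / al ^+ 3) ^+ t * (V 1 ^+ 4 * V c * V e)).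
  rewrite /wterm /wpg !wpf_split -/(V 1) -/(V c) -/(V e) /Z exprD; ring.
apply: (eqm_M RO) => //; [ | exact: (eqm_refl RO) | ].
  by have ? := wpg_O t; rewrite /wterm; subring_tac RO.
rewrite /wterm; apply: (eqm_M RO); [by subring_tac RO | by subring_tac RO | |].
  apply: (eqm_M RO); [by subring_tac RO | by subring_tac RO | | exact: (eqm_refl RO)].
  apply: (eqm_B RO); [exact: (eqm_refl RO) | apply: (eqm_M RO)] => //; first by subring_tac RO.
    exact: (eqm_refl RO).
  by rewrite mulnDr mulnA; exact: xm_mod.
apply: (eqm_M RO) => //; first by subring_tac RO.
apply: (eqm_M RO) => //; first by subring_tac RO.
exact: (eqm_X RO).
Qed.

Lemma wterm_pi k : (s < k %% m)%N -> O (wterm x al c e k / pi).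
Proof.
move=> sk; have h := wpf1_pi sk; have ? := wpf1_int k.
have ? := @wpfcE_int c k (or_introl erefl); have ? := @wpfcE_int e k (or_intror erefl).
have ? := wpg_O k; rewrite /wterm (exprS _ 3).
rewrite (_ : _ / _ = wpf x al 1 k / pi * (wpg x al k * wpf x al 1 k ^+ 3
  * wpf x al c k * wpf x al e k)); last by ring.
by apply: (subringM RO) => //; subring_tac RO.
Qed.

(** The terms t <= s cancel by antisymmetry and each term t > s vanishes by itself, so a block may
    be cut anywhere after s. *)
Lemma wterm_block b t0 : (s < t0 <= m)%N ->
  O ((\sum_(t < t0) wterm x al c e (b * m + t)) / pi).
Proof.
move=> /andP[st tm]; rewrite -(subnKC st) big_split_ord /= mulrDl; apply: (subringD RO).
  have [Z OZ hZ] := wterm_shift b; apply: eqm0P.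
  apply: (@eqm_trans _ _ RO _ (\sum_(t < s.+1) Z * wterm x al c e t)).
    by apply: (eqm_sum RO) => t; apply: hZ; exact: leq_ord.
  by rewrite -mulr_sumr; apply: eqm0; rewrite -mulrA; apply: (subringM RO) => //;
    exact: wterm_low_sum.
rewrite mulr_suml; apply: (subring_sum RO) => i; apply: wterm_pi.
have E : (s.+1 + i < m)%N by have := ltn_ord i; lia.
by rewrite modnMDl (modn_small E) addSn ltnS leq_addr.
Qed.

Lemma wterm_sum_pi K : (K %% m = 0)%N \/ (s < K %% m)%N ->
  O ((\sum_(k < K) wterm x al c e k) / pi).
Proof.
move=> hK; rewrite (divn_eq K m) big_split_ord /= mulrDl; apply: (subringD RO).
  elim: (K %/ m)%N => [|b IH]; first by rewrite mul0n big_ord0 mul0r; exact: (subring0 RO).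
  rewrite mulSn addnC big_split_ord /= mulrDl; apply: (subringD RO) => //.
  by apply: wterm_block; rewrite leqnn ltn_mod m0.
case: hK => [->|h]; first by rewrite big_ord0 mul0r; exact: (subring0 RO).
by apply: wterm_block; rewrite h ltnW // ltn_mod.
Qed.

Lemma saal_int_aux j : O (poch (x / (al * c * e)) x j * (c * e * x) ^+ j
    / (wph x c j * wph x e j)).
Proof.
have ? := x_int; have ? := alV_int; have ? := qp_c qP; have ? := qp_e qP.
have ? := qp_cV qP; have ? := qp_eV qP.
have ? : O (wph x c j)^-1.
  by rewrite /wph -prodfV; apply: (subring_prod RO) => i; rewrite -exprM; exact: (qp_cq qP).
have ? : O (wph x e j)^-1.
  by rewrite /wph -prodfV; apply: (subring_prod RO) => i; rewrite -exprM; exact: (qp_eq qP).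
have ? : O (poch (x / (al * c * e)) x j).
  by apply: (subring_poch RO) => //; rewrite !invfM; subring_tac RO.
by rewrite [(_ * wph x e j)^-1]invfM; subring_tac RO.
Qed.

(** Order bookkeeping: E and 3B zeros in the numerator against at most a + b in the denominator. *)
Lemma pi_balance P A Q T a b B E : P != 0 -> O P -> O (A / P ^+ E) -> O (Q / P ^+ B) ->
  O (P ^+ b / T.1) -> O (P ^+ a / T.2) -> (a + b <= E + 3 * B)%N ->
  O (A * Q ^+ 3 / (T.1 * T.2)).
Proof.
move=> P0 OP hA hQ h1 h2 h.
have X0 k : P ^+ k != 0 by rewrite expf_neq0.
have := subringM RO (subringM RO (subringM RO hA (subringX RO 3 hQ)) (subringM RO h1 h2))
  (subringX RO (E + 3 * B - (a + b)) OP).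
rewrite (_ : A / P ^+ E * _ * _ * _ = A * Q ^+ 3 / (T.1 * T.2) *
   (P ^+ (a + b) * P ^+ (E + 3 * B - (a + b)) / P ^+ (E + 3 * B))).
  by rewrite -exprD subnKC // divff // mulr1.
rewrite (mulnC 3 B) exprMn exprVn -exprM !exprD !invfM; ring.
Qed.

(** The poles number at most j/m + M/m (rounded down). Against them stand (M-j)/m zeros of the first
    factor and three times those of (al;x)_j, which has at least one zero unless j <= s and j < m;
    in that case no block is lost between M and M-j. *)
Lemma rhs_int : O ((\sum_(j < M.+1) saal_coef x al c e j * (poch (al ^+ 2 * x ^+ j) x (M - j)
  * (poch al x j * poch al x j * poch al x j))) / poch x x M).
Proof.
rewrite mulr_suml; apply: (subring_sum RO) => j; have jM := leq_ord j.
rewrite /saal_coef wph1E (_ : al ^+ 2 = q ^ (2 * r)) ?qx; last by rewrite mulrC -exprz_exp.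
set A := poch (q ^ _) _ _.
have := saal_int_aux j; set S := _ / _ => OS.
rewrite (_ : _ / _ = S * (A * poch al x j ^+ 3 / (poch x x j * poch x x M))); last first.
  by rewrite /S !invfM; ring.
apply: (subringM RO) => //.
have h1 := pochV_pi j; have h2 := pochV_pi M.
have hA : O (A / pi ^+ ((M - j) %/ m)) by exact: poch_pi.
have [js|js] := boolP ((j %/ m == 0) && (j <= s))%N.
  apply: (@pi_balance _ A (poch al x j) (_, _) _ _ 0 _ pi_neq0 pi_int hA _ h1 h2).
    by rewrite expr0 divr1; exact: poch_int.
  case/andP: js => /eqP -> js; rewrite addn0 muln0 addn0 leq_divRL //.
  by have := divn_eq M m; lia.
have hB : exists2 B, O (poch al x j / pi ^+ B) & (j %/ m <= B)%N && (0 < B)%N.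
  case: (posnP (j %/ m)%N) js => [j0|j1] js.
    exists 1%N => //; last by rewrite j0.
    by rewrite -[1%N]/(0.+1) -j0; apply: poch_al_pi; have := divn_eq j m; move: js; lia.
  by exists (j %/ m)%N; [exact: poch_pi | rewrite leqnn].
have [B hB1 /andP[hB2 hB3]] := hB.
apply: (@pi_balance _ A (poch al x j) (_, _) _ _ B _ pi_neq0 pi_int hA hB1 h1 h2).
(* Splitting M as j + (M-j) loses at most one complete block, which 3B with B >= 1 outweighs. *)
suff : (M %/ m < j %/ m + (M - j) %/ m + 2)%N by lia.
rewrite ltn_divLR //.
have := divn_eq j m; have := divn_eq (M - j) m; have := ltn_pmod j m0;
  have := ltn_pmod (M - j) m0.
by lia.
Qed.

(** Each 1/(1 - x^i) has at most a simple pole, cancelled by the zero of 1 - q^n. *)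
Lemma rhs_factor_int :
  O (1 - (1 - q ^+ n) ^+ 2 * \sum_(i < M) x ^+ i.+1 / (1 - x ^+ i.+1) ^+ 2).
Proof.
apply: (subringB RO); first exact: (subring1 RO).
rewrite mulr_sumr; apply: (subring_sum RO) => i.
rewrite mulrCA -exprVn -exprMn; apply: (subringM RO); first by apply: (subringX RO);
  exact: x_int.
apply: (subringX RO); rewrite -exprM.
have hn : O ((1 - q ^+ n) / pi) by rewrite exprnP; exact: qz_dvd.
have hi : O (pi / (1 - q ^+ (d * i.+1))).
  have [h|h] := boolP (m %| d * i.+1)%N.
    by apply: (qp_quot qP) => //; rewrite muln_gt0 d_gt0.
  by apply: (subringM RO); [exact: pi_int | exact: (qp_unit qP)].
by have := subringM RO hn hi; rewrite mulrA divfK // pi_neq0.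
Qed.
End Place.

(** * Sequences whose finite differences are divisible by powers of p *)

Section Newton.
Variables (F : fieldType) (O : F -> Prop) (RO : subring_pred O) (p : F).
Hypothesis Op : O p.

(* The i-th finite difference of [a] at 0 lies in [p^i O] for i <= 3; only the
   values [a 0, .., a 3] matter. *)
Definition newton_int (a : nat -> F) : Prop :=
  exists A : nat -> F, [/\ forall i, O (A i), a 0%N = A 0%N, a 1%N = A 0%N + p * A 1%N,
    a 2%N = A 0%N + 2 * p * A 1%N + p ^+ 2 * A 2%N &
    a 3%N = A 0%N + 3 * p * A 1%N + 3 * p ^+ 2 * A 2%N + p ^+ 3 * A 3%N].

Lemma newton_const z : O z -> newton_int (fun=> z).
Proof.
move=> oz; exists (fun i => if i is 0%N then z else 0).
by split=> [[|i]||||] //=; rewrite ?mulr0 ?addr0 //; exact: (subring0 RO).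
Qed.

Lemma newton_add a b : newton_int a -> newton_int b -> newton_int (fun j => a j + b j).
Proof.
move=> [A [oA a0 a1 a2 a3]] [B [oB b0 b1 b2 b3]]; exists (fun i => A i + B i).
by split=> [i||||]; rewrite ?a0 ?a1 ?a2 ?a3 ?b0 ?b1 ?b2 ?b3; [exact: (subringD RO) | ring..].
Qed.

(** Discrete Leibniz rule: the coefficients come from expanding binom(j,i) binom(j,l) in the basis
    binom(j,k). *)
Lemma newton_mul a b : newton_int a -> newton_int b -> newton_int (fun j => a j * b j).
Proof.
move=> [A [oA a0 a1 a2 a3]] [B [oB b0 b1 b2 b3]].
exists (fun i => match i with
  | 0%N => A 0%N * B 0%N
  | 1%N => A 0%N * B 1%N + A 1%N * B 0%N + p * (A 1%N * B 1%N)
  | 2%N => A 0%N * B 2%N + 2%:R * (A 1%N * B 1%N) + A 2%N * B 0%N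
         + 2%:R * p * (A 1%N * B 2%N + A 2%N * B 1%N)
         + p ^+ 2 * (A 2%N * B 2%N)
  | 3%N => A 0%N * B 3%N + 3%:R * (A 1%N * B 2%N) + 3%:R * (A 2%N * B 1%N) + A 3%N * B 0%N
         + p * (3%:R * (A 1%N * B 3%N) + 6%:R * (A 2%N * B 2%N) + 3%:R * (A 3%N * B 1%N))
         + p ^+ 2 * (3%:R * (A 2%N * B 3%N) + 3%:R * (A 3%N * B 2%N))
         + p ^+ 3 * (A 3%N * B 3%N)
  | _ => 0 end).
have hA := oA; have hB := oB.
split; first by case=> [|[|[|[|i]]]]; subring_tac RO => //.
all: by rewrite ?a0 ?a1 ?a2 ?a3 ?b0 ?b1 ?b2 ?b3; ring.
Qed.

Lemma newton_eq a b : a =1 b -> newton_int a -> newton_int b.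
Proof. by move=> ab [A [oA a0 a1 a2 a3]]; exists A; split; rewrite -?ab. Qed.

Lemma newton_opp a : newton_int a -> newton_int (fun j => - a j).
Proof.
move=> h; apply: (newton_eq (a := fun j => -1 * a j)) => [j|]; first by rewrite mulN1r.
by apply: newton_mul h; apply: newton_const; apply: (subringN RO); exact: (subring1 RO).
Qed.

Lemma newton_sum k (a : 'I_k -> nat -> F) :
  (forall i, newton_int (a i)) -> newton_int (fun j => \sum_(i < k) a i j).
Proof.
elim: k a => [|k IH] a h.
  by apply: newton_eq (newton_const (subring0 RO)) => j; rewrite big_ord0.
apply: newton_eq (newton_add (IH (fun i => a (widen_ord (leqnSn k) i)) _) (h ord_max)).
  by move=> j /=; rewrite big_ord_recr.
by move=> i.
Qed.

Lemma newton_prod k (a : 'I_k -> nat -> F) :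
  (forall i, newton_int (a i)) -> newton_int (fun j => \prod_(i < k) a i j).
Proof.
elim: k a => [|k IH] a h.
  by apply: newton_eq (newton_const (subring1 RO)) => j; rewrite big_ord0.
apply: newton_eq (newton_mul (IH (fun i => a (widen_ord (leqnSn k) i)) _) (h ord_max)).
  by move=> j /=; rewrite big_ord_recr.
by move=> i.
Qed.

Lemma newton_exp u : p != 0 -> O ((u - 1) / p) -> newton_int (fun j => u ^+ j).
Proof.
move=> p0 hu; exists (fun i => ((u - 1) / p) ^+ i).
by split=> [i||||]; [exact: (subringX RO) | field..].
Qed.

(** Models three equal factors P of which j are replaced by the congruent P'. *)
Lemma newton_mix P P' : p != 0 -> O P -> O ((P' - P) / p) ->
  newton_int (fun j => P' ^+ j * P ^+ (3 - j)).
Proof.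
move=> p0 oP h; exists (fun i => ((P' - P) / p) ^+ i * P ^+ (3 - i)).
split=> [i||||]; first by apply: (subringM RO); exact: (subringX RO).
all: by rewrite ?subSS ?subn0 ?subnn; field.
Qed.
End Newton.

(** * The congruence modulo the fourth power of Phi_n *)

Section FourthPower.
Variables (F : fieldType) (q c e : F) (n : nat) (O : F -> Prop).
Hypotheses (qG : qgeneric q c e) (qP : qplace q c e n O) (n1 : (1 < n)%N).
Let RO := qp_ring qP.
Let n0 : (0 < n)%N := ltnW n1.
Let q0 := qg_q0 qG.
Variables (d : nat) (r : int) (M W : nat).
Hypotheses (dn : coprime d n) (rM : r + (d * M)%:Z = n%:Z).
Hypotheses (MW : (M <= W)%N) (Wn : (W < n)%N).
Let Mn : (M < n)%N := leq_ltn_trans MW Wn.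
Local Notation pi := (1 - q ^+ n).
Local Notation x := (q ^+ d).
Local Notation al := (q ^ r).
Local Notation u0 := (q ^- n).
Let p0 : pi != 0 := pi_neq0 qG n1.
Let Op : O pi := pi_int qP.
Let d0 : (0 < d)%N := d_gt0 qG n1 dn.
Let x0 : x != 0 := x_neq0 qG d.
Let Ox : O x := x_int qP d.
Let al0 : al != 0 := al_neq0 qG r.
Let Oal : O al := qz_int qP r.
Let OalV : O al^-1 := alV_int qP r.

Lemma alxM : al * x ^+ M = q ^+ n. Proof. by rewrite (qx qG) rM -exprnP. Qed.
Let u0_neq0 : u0 != 0. Proof. by rewrite invr_eq0 expf_neq0. Qed.
Let Ou0 : O u0. Proof. by rewrite -exprVn; apply: (subringX RO); exact: (qp_qV qP). Qed.
Let Oqn : O (q ^+ n). Proof. by apply: (subringX RO); exact: (qp_q qP). Qed.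
Let qn0 : q ^+ n != 0. Proof. exact: expf_neq0. Qed.

Lemma u0_sub_pow j : u0 - q ^+ j = u0 * (1 - q ^+ (n + j)).
Proof. by rewrite exprD; field. Qed.

Lemma ndvd_dmul i : (0 < i < n)%N -> ~~ (n %| d * i)%N.
Proof. by case/andP=> i0 ilt; rewrite Gauss_dvdr 1?coprime_sym // gtnNdvd. Qed.

Lemma unit_1 i : (0 < i < n)%N -> 1 - x ^+ i != 0 /\ O (1 - x ^+ i)^-1.
Proof. by move=> h; apply: (unit_pl qG qP n1 dn _ h); rewrite inE eqxx. Qed.

Lemma unit_u0 i : (0 < i < n)%N -> u0 - x ^+ i != 0 /\ O (u0 - x ^+ i)^-1.
Proof.
move=> h; rewrite -exprM u0_sub_pow; split.
  by rewrite mulf_neq0 // (qg_q qG) // addn_gt0 n0.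
rewrite invfM invrK; apply: (subringM RO) => //; apply: (qp_unit qP).
by rewrite dvdn_addr // ndvd_dmul.
Qed.

Lemma u0_mod1 : eqm O pi u0 1.
Proof. by rewrite /eqm (_ : _ / _ = u0) //; field; rewrite p0 qn0. Qed.

Lemma wpf_u0_int k : (k < n)%N -> O (wpf x al u0 k).
Proof.
move=> kn; apply: (wpfz_int qP) => // i /andP[i0 ik].
by case: (@unit_u0 i); rewrite ?i0 ?(leq_ltn_trans ik).
Qed.

Lemma wpf_1_int k : O (wpf x al 1 k).
Proof. exact: (wpf1_int qG qP n1 r dn k). Qed.

Lemma wpf_u0_mod k : (k < n)%N -> eqm O pi (wpf x al u0 k) (wpf x al 1 k).
Proof.
move=> kn; have h (i : 'I_k) : (0 < i.+1 < n)%N by have := ltn_ord i; lia.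
have O1 := subring1 RO.
apply: (eqm_prod RO) => i; have [? ?] := unit_1 (h i); have [? ?] := unit_u0 (h i).
- by subring_tac RO.
- by subring_tac RO.
apply: (eqm_M RO); [by subring_tac RO | by subring_tac RO | |].
  apply: (eqm_B RO); [exact: (eqm_refl RO) | rewrite -!mulrA].
  apply: (eqm_M RO) => //; [by subring_tac RO | exact: u0_mod1 | exact: (eqm_refl RO)].
apply: (eqm_V RO) => //; apply: (eqm_B RO); [exact: u0_mod1 | exact: (eqm_refl RO)].
Qed.

Definition invsum j : F := \sum_(i < j) (1 - x ^+ i.+1)^-1.
Definition ell k : F := invsum M - invsum (M - k) - invsum k.
Definition wquo k : F := (wpf x al u0 k - wpf x al 1 k) / pi.

Lemma invsum_int j : (j < n)%N -> O (invsum j).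
Proof.
move=> jn; apply: (subring_sum RO) => i.
by case: (@unit_1 i.+1) => //; have := ltn_ord i; lia.
Qed.

Lemma ell_int k : (k <= M)%N -> O (ell k).
Proof. by move=> kM; do 2?apply: (subringB RO); apply: invsum_int; lia. Qed.

Lemma ell_sym k : (k <= M)%N -> ell (M - k) = ell k.
Proof. by move=> kM; rewrite /ell subKn //; ring. Qed.

(* Logarithmic derivative: modulo [pi], [wquo k] is the derivative of [wpf] at
   [u = 1], and its quotient by [wpf] is the symmetric function [ell]. *)
Lemma wquo_mod k : (k <= M)%N -> eqm O pi (wquo k) (wpf x al 1 k * ell k).
Proof.
elim: k => [_ | k IH kM].
  rewrite /wquo /ell /wpf !big_ord0 subrr mul0r subn0 subrr /invsum big_ord0 subr0 mulr0.
  exact: (eqm_refl RO).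
have hk : (0 < k.+1 < n)%N by lia.
have hM : (0 < M - k < n)%N by lia.
have O1 := subring1 RO.
have [B1 OB1] := unit_1 hk; have [B2 OB2] := unit_u0 hk; have [Y1 OY1] := unit_1 hM.
set g := fun z => (1 - z * al * x ^+ k) / (z - x ^+ k.+1).
have -> : wquo k.+1 = wquo k * g u0 + wpf x al 1 k * ((g u0 - g 1) / pi).
  by rewrite /wquo !wpfS -/(g u0) -/(g 1); field.
(* Logarithmic derivative of g at 1, with al x^k replaced by x^(-(M-k)); it is also the increment of
   [ell] from k to k+1. *)
set dl := (1 - x ^+ (M - k))^-1 - (1 - x ^+ k.+1)^-1.
have -> : wpf x al 1 k.+1 * ell k.+1 =
    (wpf x al 1 k * ell k) * g 1 + wpf x al 1 k * (g 1 * dl).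
  have -> : ell k.+1 = ell k + dl.
    rewrite /ell /dl -[(M - k)%N](subnSK kM) /invsum !big_ord_recr /= (subnSK kM).
    by ring.
  by rewrite wpfS -/(g 1); ring.
have Og1 : O (g 1) by rewrite /g; subring_tac RO.
have Ogu : O (g u0) by rewrite /g; subring_tac RO.
have Of := wpf_1_int k; have Ofu := wpf_u0_int (leq_ltn_trans (ltnW kM) Mn).
apply: (eqm_D RO); apply: (eqm_M RO).
- exact: (wpf_u0_mod (leq_ltn_trans (ltnW kM) Mn)).
- exact: Og1.
- exact: (IH (ltnW kM)).
- apply: (eqm_M RO); [by subring_tac RO | by subring_tac RO | |].
    apply: (eqm_B RO); [exact: (eqm_refl RO) | rewrite -!mulrA].
    apply: (eqm_M RO) => //; [by subring_tac RO | exact: u0_mod1 | exact: (eqm_refl RO)].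
  apply: (eqm_V RO) => //; apply: (eqm_B RO); [exact: u0_mod1 | exact: (eqm_refl RO)].
- exact: Of.
- by rewrite /dl; subring_tac RO.
- exact: (eqm_refl RO).
have OC : O (1 - x ^+ k.+1 * q ^+ n)^-1.
  rewrite -exprM -exprD; apply: (qp_unit qP).
  by rewrite dvdn_addl // ndvd_dmul.
have C0 : 1 - x ^+ k.+1 * q ^+ n != 0.
  by rewrite -exprM -exprD (qg_q qG) // addn_gt0 n0 orbT.
(* The quotient by [pi] in closed form; it is verified by eliminating q^n = al x^k x^(M-k). *)
rewrite /eqm (_ : _ / pi =
  (1 - al * x ^+ k * x ^+ k.+1) * x ^+ k.+1 * (1 - x ^+ k.+1 * q ^+ n)^-1
     * (1 - x ^+ k.+1)^-1 ^+ 2 - (1 - x ^+ (M - k))^-1 * (1 - x ^+ k.+1)^-1).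
  by subring_tac RO.
rewrite /dl /g.
have E : q ^+ n = al * x ^+ k * x ^+ (M - k) by rewrite -alxM -mulrA -exprD subnKC // ltnW.
move: p0 C0 B1 B2 Y1 qn0 E; rewrite exprS mulrA.
move: (x ^+ k) (x ^+ (M - k)) => X Y; move: (q ^+ n) => Q p0' C0 B1 B2 Y1 Q0 E.
subst Q.
have [h1 h2 h3] : [/\ al != 0, X != 0 & Y != 0].
  by move: Q0; rewrite !mulf_eq0 !negb_or => /andP[/andP[]].
by field; rewrite B1 Y1 C0 p0' h1 h2 h3.
Qed.

(** The fourth copy of [wpf x al 1 k] stays fixed: it is the factor (al;x)_k/(x;x)_k present in
    every such series. *)
Definition wsum u v w : F := \sum_(k < W.+1) wpg x al k
  * (wpf x al 1 k * wpf x al c k * wpf x al e k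
     * wpf x al u k * wpf x al v k * wpf x al w k).

(** Modulo [pi] the terms k <= M become [wterm] weighted by the cube of the symmetric [ell], and
    cancel. For k > M the fixed factor [wpf x al 1 k] vanishes. *)
Lemma wquo_sum : O ((\sum_(k < W.+1) wpg x al k
  * (wpf x al 1 k * wpf x al c k * wpf x al e k * wquo k ^+ 3)) / pi).
Proof.
have Oterm k (kn : (k < n)%N) : [/\ O (wpg x al k), O (wpf x al 1 k), O (wpf x al c k),
    O (wpf x al e k) & O (wquo k)].
  split; [exact: (wpg_O qP) | exact: wpf_1_int | | | exact: wpf_u0_mod].
  - by apply: (wpfcE_int qP); left.
  - by apply: (wpfcE_int qP); right.
have -> : W.+1 = (M.+1 + (W - M))%N by lia.
rewrite big_split_ord /= mulrDl; apply: (subringD RO).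
  apply: eqm0P.
  apply: (@eqm_trans _ _ RO _ (\sum_(k < M.+1) wterm x al c e k * ell k ^+ 3)).
    apply: (eqm_sum RO) => k; have kM := leq_ord k.
    have kn := leq_ltn_trans kM Mn; have Ol := ell_int kM.
    have [? ? ? ? ?] := Oterm k kn.
    have -> : wterm x al c e k * ell k ^+ 3 = wpg x al k
      * (wpf x al 1 k * wpf x al c k * wpf x al e k * (wpf x al 1 k * ell k) ^+ 3).
      by rewrite /wterm; ring.
    have ? : O ((wpf x al 1 k * ell k) ^+ 3) by subring_tac RO.
    apply: (eqm_M RO); [by [] | by subring_tac RO | exact: (eqm_refl RO) |].
    apply: (eqm_M RO); [by subring_tac RO | by [] | exact: (eqm_refl RO) |].
    by apply: (eqm_X RO); [by [] | by subring_tac RO | exact: wquo_mod].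
  apply: eqm0.
  apply: (@wterm_sum_antisym _ _ RO _ p0 x M x0 Ox _ al c e (fun k => ell k ^+ 3)
    Oal OalV al0).
  - exact: (xV_int qP).
  - exact: (qp_c qP).
  - exact: (qp_e qP).
  - by rewrite alxM -opprB mulNr divff //; apply: (subringN RO); exact: (subring1 RO).
  - move=> z i hz /andP[i0 iM]; apply: (unit_pl qG qP n1 dn hz).
    by rewrite i0 (leq_ltn_trans iM).
  - by move=> k kM; rewrite ell_sym //; exact: (eqm_refl RO).
  - by move=> k kM; apply: (subringX RO); exact: ell_int.
  - exact: (qg_2 qG).
  - exact: (qp_2V qP).
rewrite mulr_suml; apply: (subring_sum RO) => i; set k := (M.+1 + i)%N.
have kn : (k < n)%N by rewrite /k; have := ltn_ord i; lia.
have [? ? ? ? ?] := Oterm k kn.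
have h : O (wpf x al 1 k / pi).
  apply: (wpf1_pi qG qP n1 dn rM (dvdnn n)).
  by rewrite !modn_small // /k addSn ltnS leq_addr.
rewrite (_ : _ / pi = wpf x al 1 k / pi
  * (wpg x al k * (wpf x al c k * wpf x al e k * wquo k ^+ 3))).
  by subring_tac RO.
by ring.
Qed.

Lemma wsum_diff : O ((wsum 1 1 1 - 3%:R * wsum u0 1 1 + 3%:R * wsum u0 u0 1 - wsum u0 u0 u0)
  / pi ^+ 4).
Proof.
have -> : wsum 1 1 1 - 3%:R * wsum u0 1 1 + 3%:R * wsum u0 u0 1 - wsum u0 u0 u0
  = - pi ^+ 3 * (\sum_(k < W.+1) wpg x al k
  * (wpf x al 1 k * wpf x al c k * wpf x al e k * wquo k ^+ 3)).
  rewrite /wsum !mulr_sumr -!sumrB -big_split -sumrB; apply: eq_bigr => k _ /=.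
  by rewrite /wquo; field.
rewrite (_ : _ / _ = - ((\sum_(k < W.+1) wpg x al k
  * (wpf x al 1 k * wpf x al c k * wpf x al e k * wquo k ^+ 3)) / pi)).
  by apply: (subringN RO); exact: wquo_sum.
by move: (\sum_(k < _) _) => S; field.
Qed.

(** Watson's single sum when j of the three free parameters are u0 and the others 1. Watson
    evaluates j = 1, 2, 3; j = 0 is the sum in the theorem, reached by extrapolation. *)
Definition rsum (j : nat) : F := \sum_(i < M.+1) saal_coef x al c e i
  * (poch (u0 ^+ j * al ^+ 2 * x ^+ i) x (M - i)
     * (poch (u0 * al) x i ^+ j * poch al x i ^+ (3 - j))).

Lemma saal_int j : (j <= M)%N -> O (saal_coef x al c e j).
Proof.
move=> jM; have h := saal_int_aux qP d r j.
have := pochV_pi qG qP n1 dn j; rewrite divn_small ?(leq_ltn_trans jM) // expr0 mul1r => h2.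
have := subringM RO h h2; rewrite /saal_coef wph1E.
rewrite (_ : _ / _ * _ = poch (x / (al * c * e)) x j * (c * e * x) ^+ j
    / (poch x x j * wph x c j * wph x e j)) // !invfM; ring.
Qed.

(** The index j enters only through powers of u0, which is 1 modulo [pi], and through the exchange
    of j out of three congruent factors. *)
Lemma rsum_newton : newton_int O pi rsum.
Proof.
have hu : O ((u0 - 1) / pi) by exact: u0_mod1.
apply: (newton_sum RO) => // i; apply: (newton_mul RO) => //.
  by apply: (newton_const RO); apply: saal_int; exact: leq_ord.
apply: (newton_mul RO) => //.
  apply: (newton_prod RO) => // j; have O1 := subring1 RO.
  apply: (newton_add RO) => //; first by apply: (newton_const RO).
  apply: (newton_opp RO) => //.
  apply: (newton_eq (a := fun k => u0 ^+ k * (al ^+ 2 * x ^+ i * x ^+ j))).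
    by move=> k; rewrite !mulrA.
  apply: (newton_mul RO) => //; first exact: (newton_exp RO).
  by apply: (newton_const RO); subring_tac RO.
apply: (newton_mix RO) => //; first exact: (subring_poch RO).
apply: (eqm_prod RO) => j; have O1 := subring1 RO; [by subring_tac RO | by subring_tac RO |].
apply: (eqm_B RO); [exact: (eqm_refl RO) | rewrite -mulrA].
rewrite -[X in eqm _ _ _ X]mul1r.
by apply: (eqm_M RO); [| subring_tac RO | exact: u0_mod1 | exact: (eqm_refl RO)].
Qed.

Lemma watson_at v w : v \in [:: 1; u0] -> w \in [:: 1; u0] ->
  wsum u0 v w = pi / al ^+ M * wph x (q ^+ n) M / (wph x v M * wph x w M)
    * \sum_(j < M.+1) saal_coef x al c e j
        * (poch (u0 * v * w * al ^+ 2 * x ^+ j) x (M - j)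
           * (poch (u0 * al) x j * poch (v * al) x j * poch (w * al) x j)).
Proof.
move=> hv hw.
have uM : u0 * al * x ^+ M = 1 by rewrite -mulrA alxM mulVf.
have hW z : z \in [:: 1; u0] -> wph x z M != 0.
  move=> hz; apply: wph_neq0 => i /andP[i0 iM].
  have hi : (0 < i < n)%N by rewrite i0 (leq_ltn_trans iM).
  by move: hz; rewrite !inE => /orP[] /eqP ->; [case: (unit_1 hi) | case: (unit_u0 hi)].
have hN z i : z \in [:: 1; u0] -> (i < M)%N -> 1 - z * al * x ^+ i != 0.
  move=> hz iM;
    have E : q ^+ n = al * x ^+ i * x ^+ (M - i) by rewrite -alxM -mulrA -exprD subnKC // ltnW.
  have hMi : (0 < M - i < n)%N by rewrite subn_gt0 iM (leq_ltn_trans (leq_subr _ _)).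
  have [h1 _] := unit_1 hMi.
  move: hz; rewrite !inE => /orP[] /eqP ->.
    rewrite mul1r (qx qG); apply: (qz_neq0 qG n1); apply/eqP => E0.
    have : (n %| d * (M - i))%N.
      by apply/dvdnP; exists 1%N; rewrite mulnBr; lia.
    by apply/negP; exact: ndvd_dmul.
  apply: contra_neq h1 => h.
  have {h} h : u0 * al * x ^+ i = 1 by apply/esym/eqP; rewrite -subr_eq0 h.
  by apply/eqP; rewrite subr_eq0 -{1}uM -(subnKC (ltnW iM)) exprD mulrA h mul1r addKn.
rewrite /wsum (_ : W.+1 = M.+1 + (W - M))%N; last by lia.
(* Beyond k = M the factor at u0 contains 1 - u0 al x^M = 0, so W may be replaced by M. *)
rewrite big_split_ord /= [X in _ + X]big1 ?addr0 => [|k _]; last first.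
  rewrite [wpf x al u0 _](_ : _ = 0) ?mulr0 ?mul0r ?mulr0 //.
  rewrite wpfE (@poch_eq0 _ _ _ _ M) ?mul0r ?uM ?subrr //.
  by rewrite addSn ltnS leq_addr.
have hc : wph x c M != 0 by apply: wph_neq0 => i _; rewrite -exprM; exact: (qg_c qG).
have he : wph x e M != 0 by apply: wph_neq0 => i _; rewrite -exprM; exact: (qg_e qG).
have m1 : 1 \in [:: 1; u0] by rewrite inE eqxx.
have m2 : u0 \in [:: 1; u0] by rewrite !inE eqxx orbT.
rewrite (watson_terminating x0 al0 (qg_c0 qG) (qg_e0 qG) uM (hW 1 m1) hc he
  (hW u0 m2) (hW v hv) (hW w hw)) ?alxM //.
by move=> i iM; split; apply: hN.
Qed.

Lemma watson_1 : wsum u0 1 1 = pi / al ^+ M * wph x (q ^+ n) M / (wph x 1 M) ^+ 2 * rsum 1.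
Proof.
rewrite watson_at ?inE ?eqxx //; congr (_ * _).
by apply: eq_bigr => i _; rewrite !mulr1 !mul1r !expr1; ring.
Qed.

Lemma watson_2 : wsum u0 u0 1 =
  pi / al ^+ M * wph x (q ^+ n) M / (wph x u0 M * wph x 1 M) * rsum 2.
Proof.
rewrite watson_at ?inE ?eqxx ?orbT //; congr (_ * _).
by apply: eq_bigr => i _; rewrite !mulr1 !mul1r -expr2 expr1.
Qed.

Lemma watson_3 : wsum u0 u0 u0 =
  pi / al ^+ M * wph x (q ^+ n) M / (wph x u0 M) ^+ 2 * rsum 3.
Proof.
rewrite watson_at ?inE ?eqxx ?orbT //; congr (_ * _).
by apply: eq_bigr => i _; rewrite subnn !exprS !expr0 !mulr1 !mulrA.
Qed.

Definition sqsum k : F := \sum_(i < k) x ^+ i.+1 / (1 - x ^+ i.+1) ^+ 2.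

Lemma sqsum_int k : (k < n)%N -> O (sqsum k).
Proof.
move=> kn; apply: (subring_sum RO) => i; rewrite -exprVn.
by have [|_ ?] := @unit_1 i.+1; [have := ltn_ord i; lia | subring_tac RO].
Qed.

(** With B = x^i one factor is (q^n - B)(u0 - B)/(1 - B)^2 = 1 - u0 pi^2 B/(1 - B)^2, and u0 is 1
    modulo [pi]. *)
Lemma wph_pair_mod k : (k <= M)%N ->
  O ((wph x (q ^+ n) k * wph x u0 k / wph x 1 k ^+ 2 - (1 - pi ^+ 2 * sqsum k)) / pi ^+ 3).
Proof.
elim: k => [_|k IH kM].
  rewrite /wph /sqsum !big_ord0 mulr0 subr0 expr1n divr1 mulr1 subrr mul0r;
    exact: (subring0 RO).
have hk : (0 < k.+1 < n)%N by rewrite /= (leq_ltn_trans kM).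
have O1 := subring1 RO; have [B0 OB] := unit_1 hk;
  have Os := sqsum_int (leq_ltn_trans (ltnW kM) Mn).
have {IH} := IH (ltnW kM); set z := _ / pi ^+ 3 => Oz.
have E : wph x (q ^+ n) k * wph x u0 k / wph x 1 k ^+ 2 = 1 - pi ^+ 2 * sqsum k + pi ^+ 3 * z.
  by rewrite /z [pi ^+ 3 * _]mulrC divfK ?expf_neq0 // addrC subrK.
have -> : sqsum k.+1 = sqsum k + x ^+ k.+1 / (1 - x ^+ k.+1) ^+ 2.
  by rewrite /sqsum big_ord_recr.
have -> : wph x (q ^+ n) k.+1 * wph x u0 k.+1 / wph x 1 k.+1 ^+ 2
   = (1 - pi ^+ 2 * sqsum k + pi ^+ 3 * z)
     * ((q ^+ n - x ^+ k.+1) * (u0 - x ^+ k.+1) / (1 - x ^+ k.+1) ^+ 2).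
  by rewrite -E !wphS exprMn invfM; ring.
set S := sqsum k in Os *.
rewrite (_ : _ / _ = - u0 * (x ^+ k.+1 * (1 - x ^+ k.+1)^-1 ^+ 2)
   + z * (1 - pi ^+ 2 * u0 * (x ^+ k.+1 * (1 - x ^+ k.+1)^-1 ^+ 2))
   + pi * S * u0 * (x ^+ k.+1 * (1 - x ^+ k.+1)^-1 ^+ 2)).
  by subring_tac RO.
move: p0 qn0 B0; clearbody z S; move: (x ^+ k.+1) (q ^+ n) => B Q p0' Q0 B0.
by field; rewrite p0' Q0 B0.
Qed.

Lemma wph_1_neq0 : wph x 1 M != 0.
Proof. by apply: wph_neq0 => i /andP[i0 iM]; case: (@unit_1 i);
  rewrite // i0 (leq_ltn_trans iM). Qed.
Lemma wph_u0_neq0 : wph x u0 M != 0.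
Proof. by apply: wph_neq0 => i /andP[i0 iM]; case: (@unit_u0 i);
  rewrite // i0 (leq_ltn_trans iM). Qed.

(** The prefactors of the three Watson values form a geometric progression of ratio [kap], the
    quotient of [wph x 1 M] by [wph x u0 M]. Hence it is the third difference of kap^j [rsum j] that
    has to be small, and it is, since [kap] is 1 modulo [pi]. *)
Lemma wsum_mod4 :
  O ((wsum 1 1 1 - pi / al ^+ M / wph x 1 M * (1 - pi ^+ 2 * sqsum M) * rsum 0) / pi ^+ 4).
Proof.
have O1 := subring1 RO.
have h1 := wph_1_neq0; have h2 := wph_u0_neq0.
have Oh1 : O (wph x 1 M)^-1.
  rewrite /wph -prodfV; apply: (subring_prod RO) => i.
  by have [|_ ?] := @unit_1 i.+1; first by have := ltn_ord i; lia.
have Oh2 : O (wph x u0 M)^-1.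
  rewrite /wph -prodfV; apply: (subring_prod RO) => i.
  by have [|_ ?] := @unit_u0 i.+1; first by have := ltn_ord i; lia.
have [A [OA r0 r1 r2 r3]] := rsum_newton.
have Oz := wph_pair_mod (leqnn M); set z := _ / pi ^+ 3 in Oz.
have Olam : O ((wph x 1 M / wph x u0 M - 1) / pi).
  have : eqm O pi (wph x 1 M) (wph x u0 M).
    apply: (eqm_prod RO) => i; [by subring_tac RO | by subring_tac RO |].
    apply: (eqm_B RO); [apply: (eqm_sym RO); exact: u0_mod1 | exact: (eqm_refl RO)].
  move=> h; have := subringM RO Oh2 h; rewrite mulrA mulrBr mulVf //.
  by rewrite [_^-1 * _]mulrC.
set lam := _ / pi in Olam.
have Os := sqsum_int Mn.
have D := wsum_diff; rewrite watson_1 watson_2 watson_3 r1 r2 r3 in D.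
have OX : O (al ^- M) by rewrite -exprVn; exact: (subringX RO).
set kap := 1 + pi * lam.
(* The third difference of kap^j [rsum j], divided by pi^3. *)
set Xi := lam ^+ 3 * A 0%N + 3%:R * kap * lam ^+ 2 * A 1%N
  + 3%:R * kap ^+ 2 * lam * A 2%N + kap ^+ 3 * A 3%N.
(* What the Watson values contribute to the error, divided by pi^4; the rest is the bound [D]. *)
set E := al ^- M * (wph x 1 M)^-1 * (z * A 0%N + Xi * (1 - pi ^+ 2 * sqsum M + pi ^+ 3 * z)).
have OE : O E by have ? := OA; rewrite /E /Xi /kap; subring_tac RO.
rewrite r0.
suff -> : (wsum 1 1 1 - pi / al ^+ M / wph x 1 M * (1 - pi ^+ 2 * sqsum M) * A 0%N) / pi ^+ 4
  = (wsum 1 1 1 - 3%:R * (pi / al ^+ M * wph x (q ^+ n) M / (wph x 1 M) ^+ 2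
       * (A 0%N + pi * A 1%N))
   + 3%:R * (pi / al ^+ M * wph x (q ^+ n) M / (wph x u0 M * wph x 1 M)
       * (A 0%N + 2 * pi * A 1%N + pi ^+ 2 * A 2%N))
   - pi / al ^+ M * wph x (q ^+ n) M / (wph x u0 M) ^+ 2
     * (A 0%N + 3 * pi * A 1%N + 3 * pi ^+ 2 * A 2%N + pi ^+ 3 * A 3%N)) / pi ^+ 4 + E.
  exact: (subringD RO).
have Ek : wph x 1 M = wph x u0 M * kap by rewrite /kap /lam; field; rewrite p0 h2.
have kap0 : kap != 0 by move: h1; rewrite Ek mulf_eq0 negb_or => /andP[].
(* The last dependent quantity is eliminated, so that the remaining identity holds in free
   variables. *)
have Eh : wph x (q ^+ n) M = wph x u0 M * kap ^+ 2 * (1 - pi ^+ 2 * sqsum M + pi ^+ 3 * z).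
  rewrite /z Ek; field; by rewrite p0 kap0 h2.
rewrite /E /Xi Eh Ek.
move: (al ^+ M) (expf_neq0 M al0) p0 kap0 h2; rewrite /kap.
clearbody z lam.
move: (wsum 1 1 1) (wph x u0 M) (sqsum M) (A 0%N) (A 1%N) (A 2%N) (A 3%N) (1 - q ^+ n).
move=> W0 H S A0 A1 A2 A3 P a a0 P0 k0 H0.
by field; rewrite a0 P0 k0 H0.
Qed.
End FourthPower.

(** * Localization at cyclotomic polynomials and recombination *)

Lemma cross_mul (F : fieldType) (N D Y A B : F) :
  D != 0 -> Y != 0 -> B != 0 -> N / D / Y = A / B -> N * B = A * D * Y.
Proof.
move=> D0 Y0 B0 E; have -> : N = A / B * (D * Y) by rewrite -E; field; rewrite ?D0 ?Y0 ?B0.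
by field; rewrite ?D0 ?Y0 ?B0.
Qed.

Section CyclotomicPlace.
Variable K : fieldType.
Hypothesis pchar0 : forall n, (0 < n)%N -> (n%:R : K) != 0.

Definition cycP (n : nat) : {poly K} := map_poly (fun z : int => z%:~R) 'Phi_n.

Lemma prod_cycP n : (0 < n)%N -> \prod_(d <- divisors n) cycP d = 'X^n - 1.
Proof.
move=> n0; rewrite -(rmorph_prod (map_poly (intr : int -> K))) prod_Cyclotomic //.
by rewrite rmorphB rmorph1 /= map_polyXn.
Qed.

Lemma cycP_dvd n : (0 < n)%N -> cycP n %| 'X^n - 1.
Proof.
move=> n0; rewrite -prod_cycP // (big_rem n) ?dvdp_mulr //.
by rewrite -dvdn_divisors.
Qed.

(** Both divide X^(dd') - 1, which is separable in characteristic zero. *)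
Lemma cycP_coprime d d' : (0 < d)%N -> (0 < d')%N -> d != d' -> coprimep (cycP d) (cycP d').
Proof.
move=> d0 d0' dd'; set n := (d * d')%N; have n0 : (0 < n)%N by rewrite muln_gt0 d0.
have sep : separable_poly ('X^n - 1 : {poly K}) by apply: separable_Xn_sub_1; exact: pchar0.
apply: (separable_coprime sep); rewrite -prod_cycP //.
rewrite (big_rem d) /=; last by rewrite -dvdn_divisors // dvdn_mulr.
rewrite (big_rem d') /=; last first.
  by rewrite mem_rem_uniq ?divisors_uniq // !inE eq_sym dd' -dvdn_divisors // dvdn_mull.
by rewrite mulrA dvdp_mulr.
Qed.

Lemma coprimep_prod_seq (s : seq nat) (G : nat -> {poly K}) p :
  (forall d, d \in s -> coprimep (G d) p) -> coprimep (\prod_(d <- s) G d) p.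
Proof.
elim: s => [|d s IH] h; first by rewrite big_nil coprime1p.
rewrite big_cons coprimepMl h ?mem_head // IH // => d' d's.
by apply: h; rewrite inE d's orbT.
Qed.

Lemma Xn_sub_1_coprime m j : (0 < m)%N -> ~~ (m %| j)%N -> coprimep ('X^j - 1) (cycP m).
Proof.
move=> m0 mj; have j0 : (0 < j)%N by case: j mj => //; rewrite dvdn0.
rewrite -prod_cycP //; apply: coprimep_prod_seq => d; rewrite -dvdn_divisors // => dj.
apply: cycP_coprime => //; first exact: dvdn_gt0 dj.
by apply: contraNneq mj => <-.
Qed.

(** The sum is the cofactor of X^m - 1 in the separable X^(mb) - 1. *)
Lemma Xn_quot_coprime m b : (0 < m)%N -> (0 < b)%N ->
  coprimep (\sum_(i < b) 'X^m ^+ i) (cycP m).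
Proof.
move=> m0 b0; have sep : separable_poly ('X^(m * b) - 1 : {poly K}).
  by apply: separable_Xn_sub_1; apply: pchar0; rewrite muln_gt0 m0.
have : coprimep ('X^m - 1) (\sum_(i < b) 'X^m ^+ i : {poly K}).
  by apply: (separable_coprime sep); rewrite -subrX1 exprM.
by rewrite coprimep_sym; apply: coprimep_dvdl; exact: cycP_dvd.
Qed.

Lemma X_coprime m : (0 < m)%N -> coprimep 'X (cycP m).
Proof.
move=> m0; apply: (coprimep_dvdl (cycP_dvd m0)).
apply/coprimepP => g gX gm; apply: (@dvdp_eqp1 _ _ 1); last exact: eqpxx.
have : g %| 'X^m by apply: dvdp_trans gX _; rewrite -(prednK m0) exprS dvdp_mulr.
by move=> h; rewrite -(subKr 'X^m 1) dvdp_sub.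
Qed.

(** Modulo a common divisor with X^m - 1 one has z^m = X^(jm) = 1, so the divisor divides a nonzero
    constant. *)
Lemma const_coprime (z : K) m j : (0 < m)%N -> z ^+ m != 1 -> coprimep (z%:P - 'X^j) (cycP m).
Proof.
move=> m0 zm; apply: (coprimep_dvdl (cycP_dvd m0)); apply/coprimepP => g gz gm.
apply: (@dvdp_eqp1 _ _ (z ^+ m - 1)%:P); last by rewrite polyC_eqp1 subr_eq0.
have h1 : g %| z%:P ^+ m - 'X^j ^+ m by apply: dvdp_trans gz _; rewrite subrXX dvdp_mulr.
have h2 : g %| 'X^m ^+ j - 1 by apply: dvdp_trans gm _; rewrite (subrX1 'X^m j) dvdp_mulr.
rewrite polyCB polyC1 polyC_exp -(subrK ('X^j ^+ m) (z%:P ^+ m)) -addrA.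
by rewrite dvdp_add // -exprM mulnC exprM.
Qed.

Local Notation T := {fraction {poly K}}.
Local Notation tf := (@tofrac {poly K}).

Definition cycO (m : nat) (z : T) : Prop :=
  exists A B : {poly K}, [/\ B != 0, coprimep B (cycP m) & z = tf A / tf B].

Lemma cycO_ring m : subring_pred (cycO m).
Proof.
split.
- by exists 1, 1; rewrite oner_eq0 coprime1p tofrac1 divr1.
- move=> _ _ [A [B [B0 cB ->]]] [C [D [D0 cD ->]]]; exists (A * D - C * B), (B * D).
  split; [by rewrite mulf_neq0 | by rewrite coprimepMl cB | rewrite tofracB !tofracM].
  rewrite -mulNr addf_div ?tofrac_eq0 //; by rewrite mulNr.
- move=> _ _ [A [B [B0 cB ->]]] [C [D [D0 cD ->]]]; exists (A * C), (B * D).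
  split; [by rewrite mulf_neq0 | by rewrite coprimepMl cB | by rewrite !tofracM mulf_div].
Qed.

Lemma cycO_poly m A : cycO m (tf A).
Proof. by exists A, 1; rewrite oner_eq0 coprime1p tofrac1 divr1. Qed.

Lemma cycO_inv m B : B != 0 -> coprimep B (cycP m) -> cycO m (tf B)^-1.
Proof. by move=> B0 cB; exists 1, B; rewrite tofrac1 div1r. Qed.

Variables (c0 e0 : K).
Hypotheses (c0X : forall j, (0 < j)%N -> c0 ^+ j != 1).
Hypotheses (e0X : forall j, (0 < j)%N -> e0 ^+ j != 1).
Hypotheses (c0_neq0 : c0 != 0) (e0_neq0 : e0 != 0).
Local Notation q := (tf 'X).
Local Notation c := (tf c0%:P).
Local Notation e := (tf e0%:P).

Lemma onem_Xn_neq0 j : (0 < j)%N -> (1 - 'X^j : {poly K}) != 0.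
Proof.
move=> j0; rewrite subr_eq0; apply/eqP => /(congr1 (fun p : {poly K} => p`_j)) /eqP.
by rewrite coef1 coefXn eqxx -(negbK (j == 0%N)) -lt0n j0 /= eq_sym oner_eq0.
Qed.

Lemma const_sub_Xn_neq0 (z : K) j : (forall i, (0 < i)%N -> z ^+ i != 1) ->
  z%:P - 'X^j != 0 :> {poly K}.
Proof.
move=> hz; rewrite subr_eq0; case: j => [|j].
  by rewrite expr0; apply: contraNneq (hz 1%N isT) => /polyC_inj ->; rewrite expr1n.
apply/eqP => /(congr1 (fun p : {poly K} => p`_j.+1)) /eqP.
by rewrite coefC coefXn eqxx /= eq_sym oner_eq0.
Qed.

Lemma cyc_generic : qgeneric q c e.
Proof.
split.
- by rewrite tofrac_eq0 polyX_eq0.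
- by rewrite tofrac_eq0 polyC_eq0.
- by rewrite tofrac_eq0 polyC_eq0.
- by move=> j j0; rewrite -tofracXn -tofrac1 -tofracB tofrac_eq0 onem_Xn_neq0.
- by move=> j; rewrite -tofracXn -tofracB tofrac_eq0 const_sub_Xn_neq0.
- by move=> j; rewrite -tofracXn -tofracB tofrac_eq0 const_sub_Xn_neq0.
- rewrite -(rmorph_nat tf) tofrac_eq0 -polyC_natr polyC_eq0; exact: pchar0.
Qed.

Lemma cyc_place m : (0 < m)%N -> qplace q c e m (cycO m).
Proof.
move=> m0; have cC (z : K) : z != 0 -> coprimep z%:P (cycP m).
  by move=> z0; rewrite (eqp_coprimepl _ (_ : z%:P %= 1)) ?coprime1p // polyC_eqp1.
split.
- exact: cycO_ring.
- exact: cycO_poly.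
- by apply: cycO_inv; [rewrite polyX_eq0 | exact: X_coprime].
- exact: cycO_poly.
- by apply: cycO_inv; [rewrite polyC_eq0 | exact: cC].
- exact: cycO_poly.
- by apply: cycO_inv; [rewrite polyC_eq0 | exact: cC].
- rewrite -(rmorph_nat tf) -polyC_natr.
  by apply: cycO_inv; [rewrite polyC_eq0 pchar0 | apply: cC; exact: pchar0].
- move=> j mj; rewrite -tofracXn -tofrac1 -tofracB; apply: cycO_inv.
    by apply: onem_Xn_neq0; case: j mj => //; rewrite dvdn0.
  by apply: (coprimep_dvdr _ (Xn_sub_1_coprime m0 mj)); rewrite -opprB dvdpNl.
- move=> j j0 /dvdnP[b jb].
  have b0 : (0 < b)%N by move: j0; rewrite jb muln_gt0 => /andP[].
  have E : 1 - 'X^j = (1 - 'X^m) * \sum_(i < b) 'X^m ^+ i :> {poly K}.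
    by rewrite -(opprB 'X^m) mulNr -subrX1 -exprM mulnC -jb opprB.
  rewrite -!tofracXn -tofrac1 -!tofracB E tofracM invfM mulVKf.
    apply: cycO_inv; last exact: Xn_quot_coprime.
    by have := onem_Xn_neq0 j0; rewrite E mulf_eq0 negb_or => /andP[].
  by rewrite tofrac_eq0 onem_Xn_neq0.
- move=> j; rewrite -tofracXn -tofracB; apply: cycO_inv; first exact: const_sub_Xn_neq0.
  by apply: const_coprime => //; exact: c0X.
- move=> j; rewrite -tofracXn -tofracB; apply: cycO_inv; first exact: const_sub_Xn_neq0.
  by apply: const_coprime => //; exact: e0X.
Qed.

Lemma num_dvd m k (N D : {poly K}) : (0 < m)%N -> D != 0 ->
  cycO m (tf N / tf D / (1 - q ^+ m) ^+ k) -> coprimep D N -> cycP m ^+ k %| N.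
Proof.
move=> m0 D0 [A [B [B0 cB E]]] cDN.
have X0 : (1 - 'X^m : {poly K}) != 0 by exact: onem_Xn_neq0.
have E' : N * B = A * D * (1 - 'X^m) ^+ k.
  apply/eqP; rewrite -tofrac_eq !tofracM tofracXn tofracB tofrac1 tofracXn; apply/eqP.
  apply: cross_mul E; rewrite ?tofrac_eq0 //.
  by apply: expf_neq0; exact: (qg_q cyc_generic m0).
have cBk : coprimep (cycP m ^+ k) B by rewrite coprimep_sym coprimep_expr.
rewrite -(Gauss_dvdpl _ cBk) E' dvdp_mull // dvdp_exp2r //.
by rewrite -opprB dvdpNr cycP_dvd.
Qed.

(** Integrality at each place is turned into divisibility of the numerator by each cyclotomic power;
    pairwise coprimality multiplies these together. *)
Lemma qcong_of_places (n : nat) (z : T) : (1 < n)%N ->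
  (forall m, (1 < m)%N -> (m %| n)%N -> (m < n)%N -> cycO m (z / (1 - q ^+ m))) ->
  cycO n (z / (1 - q ^+ n) ^+ 4) ->
  exists A B : {poly K}, [/\ B != 0, coprimep B ((\sum_(i < n) 'X^i) * cycP n ^+ 3)
    & z = tf ((\sum_(i < n) 'X^i) * cycP n ^+ 3 * A) / tf B].
Proof.
move=> n1 hm hn; have n0 := ltnW n1.
(* Lowest terms: once the modulus divides N, D is coprime to it as well. *)
have [N [D [D0 cDN zE]]] : exists N D : {poly K}, [/\ D != 0, coprimep D N & z = tf N / tf D].
  have [A [B [B0 _ zE]]] := hn.
  have X0 : (1 - q ^+ n) ^+ 4 != 0 by apply: expf_neq0; exact: (qg_q cyc_generic n0).
  set A' := A * (1 - 'X^n) ^+ 4; set g := gcdp A' B.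
  have g0 : g != 0 by rewrite gcdp_eq0 negb_and B0 orbT.
  have EA : A' %/ g * g = A' by rewrite divpK ?dvdp_gcdl.
  have EB : B %/ g * g = B by rewrite divpK ?dvdp_gcdr.
  exists (A' %/ g), (B %/ g); split.
  - by apply: contraNneq B0 => h; rewrite -EB h mul0r.
  - by rewrite coprimep_sym coprimep_div_gcd // B0 orbT.
  have -> : z = tf A' / tf B.
    by rewrite tofracM tofracXn tofracB tofrac1 tofracXn mulrAC -zE divfK.
  rewrite -{1}EA -{1}EB !tofracM invfM mulrACA divff ?mulr1 //.
  by rewrite tofrac_eq0.
set s := [seq d <- divisors n | (d != 1) && (d != n)]%N.
have us : uniq s by rewrite filter_uniq // divisors_uniq.
have hs d : d \in s -> [/\ (1 < d)%N, (d %| n)%N & (d < n)%N].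
  rewrite mem_filter -dvdn_divisors // => /andP[/andP[d1 dn] dvd]; split=> //.
    by have := dvdn_gt0 n0 dvd; lia.
  by have := dvdn_leq n0 dvd; lia.
(* [n] contributes one more factor Phi_n, whence the exponent 4. *)
have PE : (\sum_(i < n) 'X^i) * cycP n ^+ 3 = \prod_(d <- s) cycP d * cycP n ^+ 4.
  have X1 : ('X - 1 : {poly K}) != 0 by rewrite polyXsubC_eq0.
  have c1 : cycP 1 = 'X - 1 by have := prod_cycP (ltn0Sn 0);
    rewrite /divisors /= big_seq1 expr1.
  apply: (mulfI X1); rewrite mulrA -subrX1 -prod_cycP //.
  rewrite (bigD1_seq 1%N) ?divisors_uniq -?dvdn_divisors //= c1 -!mulrA; congr (_ * _).
  rewrite -big_filter (bigD1_seq n) ?filter_uniq ?divisors_uniq //=; last first.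
    by rewrite mem_filter -dvdn_divisors // dvdnn andbT; lia.
  rewrite -big_filter -filter_predI (eq_filter (a2 := fun d => (d != 1) && (d != n))%N).
    by rewrite -/s; ring.
  by move=> d /=; rewrite andbC.
have PN : \prod_(d <- s) cycP d * cycP n ^+ 4 %| N.
  rewrite Gauss_dvdp; last first.
    apply: coprimep_expr; apply: coprimep_prod_seq => d /hs[d1 dn dlt].
    by apply: cycP_coprime; rewrite // ?ltn_eqF // ltnW.
  apply/andP; split; last by apply: num_dvd D0 _ cDN; rewrite // -zE.
  have : forall d, d \in s -> cycP d %| N.
    move=> d /hs[d1 dn dlt]; rewrite -[cycP d]expr1.
    apply: num_dvd D0 _ cDN; first exact: ltnW d1.
    by rewrite expr1 -zE; apply: hm.
  have : forall d, d \in s -> (0 < d)%N by move=> d /hs[/ltnW].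
  elim: s us {hs PE} => [|d s IH] /=; first by rewrite big_nil dvd1p.
  move=> /andP[ds us] hpos hdvd; rewrite big_cons Gauss_dvdp; last first.
    rewrite coprimep_sym; apply: coprimep_prod_seq => d' d's; apply: cycP_coprime.
    - by rewrite hpos // inE d's orbT.
    - by rewrite hpos // mem_head.
    - by apply: contraNneq ds => <-.
  rewrite hdvd ?mem_head //=; apply: IH => // d' d's; first by rewrite hpos // inE d's orbT.
  by rewrite hdvd // inE d's orbT.
exists (N %/ (\prod_(d <- s) cycP d * cycP n ^+ 4)), D; rewrite PE; split=> //.
  exact: coprimep_dvdl PN cDN.
by rewrite divpKC.
Qed.
End CyclotomicPlace.

(** * Normal form of the two sides *)

Section Sides.
Variables (F : fieldType) (q c e : F).
Hypothesis qG : qgeneric q c e.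
Let q0 := qg_q0 qG.
Variables (d : nat) (r : int).
Hypothesis d0 : (0 < d)%N.
Local Notation x := (q ^+ d).
Local Notation al := (q ^ r).
Let fqint (m : int) : F := (1 - q ^ m) / (1 - q).

(** Spelled like the left side of the theorem, but over any field, so that the theorem is an
    instance by conversion; likewise [rhs_sum]. *)
Definition lhs_sum (W : nat) : F :=
  \sum_(0 <= k < W.+1)
    fqint ((2 * d * k)%:Z + r)
      * poch al x k ^+ 4 * poch (c * al) x k * poch (e * al) x k
      / (poch x x k ^+ 4 * poch (x / c) x k * poch (x / e) x k)
      * (c * e) ^- k * q ^ ((2 * d%:Z - 3 * r) * k%:Z).

Definition rhs_sum (n M : nat) : F :=
  fqint n%:Z * q ^ (- (r * M%:Z)) / poch x x M
    * (1 - fqint n%:Z ^+ 2 * \sum_(1 <= i < M.+1) q ^+ (d * i) / fqint (d * i)%:Z ^+ 2)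
    * \sum_(0 <= k < M.+1)
        (poch (q ^ (2 * r + (d * k)%:Z)) x (M - k)
         * poch (q ^ (d%:Z - r) / (c * e)) x k * poch al x k ^+ 3
         / (poch (x / c) x k * poch (x / e) x k * poch x x k) * q ^+ (d * k)).

Let x0 : x != 0 := x_neq0 qG d.
Let al0 : al != 0 := al_neq0 qG r.
Let c0 := qg_c0 qG.
Let e0 := qg_e0 qG.

Lemma wph_gen k : [/\ wph x 1 k != 0, wph x c k != 0 & wph x e k != 0].
Proof.
split; apply: wph_neq0 => i /andP[i0 _]; rewrite -exprM.
- by rewrite (qg_q qG) // muln_gt0 d0.
- exact: (qg_c qG).
- exact: (qg_e qG).
Qed.

Lemma onemq_neq0 : 1 - q != 0.
Proof. by have := qg_q qG (ltn0Sn 0); rewrite expr1. Qed.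

Lemma lhs_sumE W : lhs_sum W = (\sum_(k < W.+1) wterm x al c e k) / (1 - q).
Proof.
rewrite /lhs_sum big_mkord mulr_suml; apply: eq_bigr => k _.
have [h1 hc he] := wph_gen k; have p1 := onemq_neq0.
have -> : fqint ((2 * d * k)%:Z + r) = (1 - al * x ^+ (2 * k)) / (1 - q).
  by rewrite /fqint (qx qG); congr ((1 - q ^ _) / _); lia.
have -> : q ^ ((2 * d%:Z - 3 * r) * k%:Z) = (x ^+ 2 / al ^+ 3) ^+ k.
  rewrite -exprz_exp -exprnP expfzDr //; congr ((_ * _) ^+ _).
    by rewrite -exprM exprnP PoszM mulrC.
  by rewrite (exprnP al) exprz_exp invr_expz mulrC.
rewrite /wterm /wpg !wpfE !poch_divE // -wph1E mul1r.
rewrite !exprMn !exprVn.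
move: (poch al x k) (poch (c * al) x k) (poch (e * al) x k) => P1 P2 P3.
move: h1 hc he; move: (wph x 1 k) (wph x c k) (wph x e k) => H1 H2 H3 h1 h2 h3.
have := expf_neq0 k c0; have := expf_neq0 k e0; move: (c ^+ k) (e ^+ k) => C E hC hE.
have := expf_neq0 k (expf_neq0 3 al0).
move: ((al ^+ 3) ^+ k) ((x ^+ 2) ^+ k) (al * x ^+ _) => A X Y hA.
by field; rewrite h1 h2 h3 hC hE hA p1.
Qed.

Lemma rhs_sumE n M : (M < n)%N ->
  rhs_sum n M = (1 - q ^+ n) / al ^+ M / wph x 1 M
    * (1 - (1 - q ^+ n) ^+ 2 * \sum_(i < M) x ^+ i.+1 / (1 - x ^+ i.+1) ^+ 2)
    * (\sum_(j < M.+1) saal_coef x al c e j * (poch (al ^+ 2 * x ^+ j) x (M - j)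
         * (poch al x j * poch al x j * poch al x j))) / (1 - q).
Proof.
move=> Mn; have p1 := onemq_neq0; rewrite /rhs_sum.
have -> : \sum_(1 <= i < M.+1) q ^+ (d * i) / fqint (d * i)%:Z ^+ 2
  = (1 - q) ^+ 2 * \sum_(i < M) x ^+ i.+1 / (1 - x ^+ i.+1) ^+ 2.
  rewrite big_add1 /= big_mkord mulr_sumr; apply: eq_bigr => i _.
  rewrite /fqint -exprnP -exprM expr_div_n invf_div mulrA mulrAC [_ * (1 - q) ^+ 2]mulrC.
  by rewrite !mulrA.
have -> : \sum_(0 <= k < M.+1)
        (poch (q ^ (2 * r + (d * k)%:Z)) x (M - k)
         * poch (q ^ (d%:Z - r) / (c * e)) x k * poch al x k ^+ 3
         / (poch (x / c) x k * poch (x / e) x k * poch x x k) * q ^+ (d * k))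
  = \sum_(j < M.+1) saal_coef x al c e j * (poch (al ^+ 2 * x ^+ j) x (M - j)
         * (poch al x j * poch al x j * poch al x j)).
  rewrite big_mkord; apply: eq_bigr => k _; have [h1 hc he] := wph_gen k.
  rewrite (_ : al ^+ 2 * x ^+ k = q ^ (2 * r + (d * k)%:Z)); last first.
    by rewrite -(qx qG); congr (_ * _); rewrite exprnP exprz_exp mulrC.
  rewrite (_ : q ^ (d%:Z - r) / (c * e) = x / (al * c * e)); last first.
    by rewrite expfzDr // -invr_expz -exprnP; field; rewrite c0 e0 al0.
  rewrite /saal_coef (poch_divE x k c0) (poch_divE x k e0) -(wph1E q d k) exprM !exprMn.
  have := expf_neq0 k c0; have := expf_neq0 k e0; move: (c ^+ k) (e ^+ k) => C E hC hE.
  move: h1 hc he; move: (wph x 1 k) (wph x c k) (wph x e k) => H1 H2 H3 h1 h2 h3.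
  move: (poch al x k) (poch (x / _) x k) (poch _ x _) => P1 P2 P3.
  by field; rewrite h1 h2 h3 hC hE.
have -> : q ^ (- (r * M%:Z)) = (al ^+ M)^-1 by rewrite exprnP exprz_exp invr_expz.
rewrite wph1E /fqint -exprnP.
move: (\sum_(i < M) _) (\sum_(j < M.+1) _) => S1 S2.
have hM : wph x 1 M != 0 by case: (wph_gen M).
move: hM (expf_neq0 M al0); rewrite wph1E; move: (poch x x M) (al ^+ M) => H A hM hA.
by field; rewrite hM hA p1.
Qed.
End Sides.

(** * Local congruences and the theorem *)

Section Local.
Variables (F : fieldType) (q c e : F) (m : nat) (O : F -> Prop).
Hypotheses (qG : qgeneric q c e) (qP : qplace q c e m O) (m1 : (1 < m)%N).
Variables (d : nat) (r : int) (n M W : nat).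
Hypotheses (dn : coprime d n) (rM : r + (d * M)%:Z = n%:Z) (Mn : (M < n)%N).
Hypotheses (hW : W = M \/ W = n.-1).
Let RO := qp_ring qP.

Lemma onemqV_int : O (1 - q)^-1.
Proof.
by have := qp_unit qP (j := 1); rewrite expr1; apply; rewrite dvdn1 gtn_eqF.
Qed.

(** On the right the single zero comes from 1 - q^n, everything else being integral. *)
Lemma local_proper : (m %| n)%N ->
  O ((lhs_sum q c e d r W - rhs_sum q c e d r n M) / (1 - q ^+ m)).
Proof.
move=> mn; have n0 : (0 < n)%N by lia.
have dm : coprime d m := coprime_dvdr mn dn.
have d0 := d_gt0 qG m1 dm.
rewrite (lhs_sumE qG r d0) (rhs_sumE qG r d0 Mn) -mulrBl mulrAC.
apply: (subringM RO); last exact: onemqV_int.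
rewrite mulrBl; apply: (subringB RO).
  apply: (wterm_sum_pi qG qP m1 dm rM mn n0); case: hW => ->.
    (* M + 1 is either divisible by m or of remainder s + 1, so it is an admissible cut. *)
    by rewrite modnS; case: ifP => _; [left | right].
  by left; apply/eqP; rewrite prednK.
have h1 := rhs_int qG qP m1 dm rM mn n0; have h2 := rhs_factor_int qG qP m1 dm M mn.
have h3 : O ((1 - q ^+ n) / (1 - q ^+ m)) by rewrite exprnP; exact: (qz_dvd qG qP).
have h4 : O ((q ^ r) ^- M) by rewrite -exprVn; apply: (subringX RO); exact: (alV_int qP).
rewrite wph1E; move: (subringM RO (subringM RO h1 h2) (subringM RO h3 h4)).
set R := \sum_(j < M.+1) _; set S := \sum_(i < M) _.
move: (poch _ _ M) ((q ^ r) ^+ M) (1 - q ^+ m) (1 - q ^+ n) => P A B C.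
by rewrite (_ : C / A / P * _ * R / B = R / P * (1 - C ^+ 2 * S) * (C / B / A)) //; ring.
Qed.
End Local.

Lemma local_top (F : fieldType) (q c e : F) (n : nat) (O : F -> Prop)
    (d : nat) (r : int) (M W : nat) :
  qgeneric q c e -> qplace q c e n O -> (1 < n)%N -> coprime d n ->
  r + (d * M)%:Z = n%:Z -> (M <= W)%N -> (W < n)%N ->
  O ((lhs_sum q c e d r W - rhs_sum q c e d r n M) / (1 - q ^+ n) ^+ 4).
Proof.
move=> qG qP n1 dn rM MW Wn; have Mn := leq_ltn_trans MW Wn.
have d0 := d_gt0 qG n1 dn; have RO := qp_ring qP.
rewrite (lhs_sumE qG r d0) (rhs_sumE qG r d0 Mn) -mulrBl mulrAC.
apply: (subringM RO); last exact: (onemqV_int qP n1).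
have := wsum_mod4 qG qP n1 dn rM MW Wn; rewrite /sqsum.
have -> : wsum q c e d r W 1 1 1 = \sum_(k < W.+1) wterm (q ^+ d) (q ^ r) c e k.
  by apply: eq_bigr => k _; rewrite /wterm; ring.
have -> // : rsum q c e n d r M 0 = \sum_(j < M.+1) saal_coef (q ^+ d) (q ^ r) c e j *
  (poch ((q ^ r) ^+ 2 * (q ^+ d) ^+ j) (q ^+ d) (M - j) *
   (poch (q ^ r) (q ^+ d) j * poch (q ^ r) (q ^+ d) j * poch (q ^ r) (q ^+ d) j)).
by apply: eq_bigr => k _; rewrite !expr0 !mul1r -expr2 -exprSr.
Qed.

(** M < n because 2M <= dM = n - r <= n + 1, and d is prime to n because n is 1 or -1 modulo d. *)
Lemma Mof_spec (n d : nat) (r : int) : (1 < n)%N -> (2 <= d)%N -> (r = 1 \/ r = -1) ->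
  (n%:Z = r %[mod d%:Z])%Z ->
  [/\ r + (d * Mof n d r)%:Z = n%:Z, (Mof n d r < n)%N & coprime d n].
Proof.
move=> n1 d2 hr /eqP; rewrite eqz_mod_dvd => hd.
have rM : r + (d * Mof n d r)%:Z = n%:Z.
  rewrite PoszM /Mof gez0_abs; last by rewrite divz_ge0; [case: hr => ->; lia | lia].
  by rewrite mulrC divzK // addrC subrK.
split=> //.
  have : (2 * Mof n d r <= d * Mof n d r)%N by rewrite leq_mul2r d2 orbT.
  by move: rM; case: hr => ->; lia.
rewrite -[coprime _ _]/(coprimez d n) /coprimez -rM PoszM addrC mulrC gcdzMDl.
by case: hr => ->; rewrite ?gcdzN gcdz1.
Qed.

Lemma K_pchar0 n : (0 < n)%N -> (n%:R : Kce) != 0.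
Proof.
move=> n0; rewrite -(rmorph_nat (@tofrac {poly {poly rat}})) tofrac_eq0.
by rewrite -!polyC_natr !polyC_eq0 pnatr_eq0 -lt0n.
Qed.

Theorem theorem3p1 (n d : nat) (r : int) (W : nat) :
  (1 < n)%N -> (2 <= d)%N -> (r = 1 \/ r = -1) ->
  (n%:Z = r %[mod d%:Z])%Z ->
  (W = Mof n d r \/ W = n.-1) ->
  qcong
    (\sum_(0 <= k < W.+1)
        qint ((2 * d * k)%:Z + r)
        * qpoch (qv ^ r) (qv ^+ d) k ^+ 4
        * qpoch (cv * qv ^ r) (qv ^+ d) k * qpoch (ev * qv ^ r) (qv ^+ d) k
        / (qpoch (qv ^+ d) (qv ^+ d) k ^+ 4
           * qpoch (qv ^+ d / cv) (qv ^+ d) k * qpoch (qv ^+ d / ev) (qv ^+ d) k)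
        * (cv * ev) ^- k
        * qv ^ ((2 * d%:Z - 3 * r) * k%:Z))
    (qint n%:Z * qv ^ (- (r * (Mof n d r)%:Z)) / qpoch (qv ^+ d) (qv ^+ d) (Mof n d r)
      * (1 - qint n%:Z ^+ 2
             * \sum_(1 <= i < (Mof n d r).+1) qv ^+ (d * i) / qint (d * i)%:Z ^+ 2)
      * \sum_(0 <= k < (Mof n d r).+1)
          (qpoch (qv ^ (2 * r + (d * k)%:Z)) (qv ^+ d) (Mof n d r - k)
           * qpoch (qv ^ (d%:Z - r) / (cv * ev)) (qv ^+ d) k
           * qpoch (qv ^ r) (qv ^+ d) k ^+ 3
           / (qpoch (qv ^+ d / cv) (qv ^+ d) k * qpoch (qv ^+ d / ev) (qv ^+ d) k
              * qpoch (qv ^+ d) (qv ^+ d) k)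
           * qv ^+ (d * k)))
    (qintP n * PhiP n ^+ 3).
Proof.
move=> n1 d2 hr hd hW; have [rM Mn dn] := Mof_spec n1 d2 hr hd.
(* [qint] and [qpoch] are convertible to their generic forms at [qv]. *)
change (qcong (lhs_sum qv cv ev d r W) (rhs_sum qv cv ev d r n (Mof n d r))
  (qintP n * PhiP n ^+ 3)).
pose cK : Kce := tofrac (('X : {poly rat})%:P : {poly {poly rat}}).
pose eK : Kce := tofrac ('X : {poly {poly rat}}).
have cX j : (0 < j)%N -> cK ^+ j != 1.
  move=> j0; rewrite /cK -tofracXn -tofrac1 tofrac_eq -polyC_exp -polyC1.
  apply/eqP => /polyC_inj /(congr1 (fun p : {poly rat} => size p)) /eqP.
  by rewrite size_polyXn size_poly1 eqSS; case: j j0.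
have eX j : (0 < j)%N -> eK ^+ j != 1.
  move=> j0; rewrite /eK -tofracXn -tofrac1 tofrac_eq.
  apply/eqP => /(congr1 (fun p : {poly {poly rat}} => size p)) /eqP.
  by rewrite size_polyXn size_poly1 eqSS; case: j j0.
have cK0 : cK != 0 by rewrite tofrac_eq0 polyC_eq0 polyX_eq0.
have eK0 : eK != 0 by rewrite tofrac_eq0 polyX_eq0.
have qG := cyc_generic K_pchar0 cX eX cK0 eK0.
have qP m (m0 : (0 < m)%N) := cyc_place K_pchar0 cX eX cK0 eK0 m0.
apply: (@qcong_of_places Kce K_pchar0 cK eK cX eX cK0 eK0 n _ n1).
  move=> m m1 mn _; apply: (local_proper qG (qP m (ltnW m1)) m1 dn rM Mn hW mn).
have [MW Wn] : (Mof n d r <= W)%N /\ (W < n)%N by case: hW => ->; lia.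
exact: (local_top qG (qP n (ltnW n1)) n1 dn rM MW Wn).
Qed.
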